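(* There is an absolute constant $c>0$ such that the following holds. Let $k,n$ be positive integers. Let $C=\{\pm a_1,\ldots,\pm a_k\} \pmod n\subseteq \mathbb{Z}_n\setminus\{0\}$, where $a_1,\ldots,a_k$ form an arithmetic progression. Let $X=X(\mathbb{Z}_n,C)$ be the circulant graph. Then we can partition $C$ into symmetric subsets $C_1\cup C_2$, in time polynomial in $k$, such that $$\left(\frac12-\frac{c}{\sqrt{k}}\right)L_X\preccurlyeq L_{X(\mathbb{Z}_n,C_i)}\preccurlyeq\left(\frac12+\frac{c}{\sqrt{k}}\right)L_X\qquad\text{for all } i\in\{1,2\}.$$
   Context: $\mathbb{Z}_n$ is the additive group of integers modulo $n$. A set $S\subseteq\mathbb{Z}_n$ is symmetric if $x\in S\iff -x\in S$. For a symmetric set $S\subseteq\mathbb{Z}_n\setminus\{0\}$, the circulant graph $X(\mathbb{Z}_n,S)$ is the undirected graph with vertex set $\mathbb{Z}_n$ in which $i,j$ are adjacent iff $i-j\in S$. The Laplacian of a graph $G=(V,E)$ is $L_G=\sum_{(u,v)\in E}(\chi_u-\chi_v)(\chi_u-\chi_v)^\top$, where $\chi_u\in\mathbb{R}^V$ is the indicator vector of $u$ and each undirected edge is counted once. For symmetric real matrices, $A\preccurlyeq B$ means that $B-A$ is positive semidefinite.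
   Formalization: The terms a_1,…,a_k are assumed pairwise distinct modulo n; with repeated terms, e.g. all a_i = 1, C = {1,−1} has only the trivial symmetric partition and the claimed bound fails for large k. *)

(* Defs.v *)
From HB Require Import structures.
From mathcomp Require Import all_boot all_order all_algebra.
From mathcomp Require Import reals.
Set Implicit Arguments.
Unset Strict Implicit.
Unset Printing Implicit Defensive.
Import Order.TTheory GRing.Theory Num.Theory.
Local Open Scope ring_scope.

(* The cyclic group of integers modulo n.+1 is 'I_n.+1 with the zmodType
   structure of zmodp (unlike 'Z_n, it is correct for every positive modulus). *)

Definition symmetric_set (n : nat) (S : {set 'I_n.+1}) : Prop :=
  forall x, (x \in S) = (- x \in S).

Definition circulant (n : nat) (S : {set 'I_n.+1}) : rel 'I_n.+1 :=
  fun i j => i - j \in S.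

(* The condition u < v selects each undirected edge exactly once. *)
Definition laplacian (R : realType) (m : nat) (e : rel 'I_m) : 'M[R]_m :=
  \sum_(u < m) \sum_(v < m | (u < v)%N && e u v)
    let chi (w : 'I_m) : 'cV[R]_m := delta_mx w 0 in
    (chi u - chi v) *m (chi u - chi v)^T.

Definition psd (R : realType) (m : nat) (A : 'M[R]_m) : Prop :=
  A^T = A /\ forall x : 'cV[R]_m, 0 <= (x^T *m A *m x) 0 0.

Definition loewner_le (R : realType) (m : nat) (A B : 'M[R]_m) : Prop :=
  psd (B - A).

Definition arith_progression (k n : nat) (a : 'I_k -> 'I_n.+1) : Prop :=
  exists b d : 'I_n.+1, forall i : 'I_k, a i = b + d *+ i.

Definition pm_set (k n : nat) (a : 'I_k -> 'I_n.+1) : {set 'I_n.+1} :=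
  [set x | [exists i : 'I_k, (x == a i) || (x == - a i)]].

(* Model of computation: a random access machine with statically addressed
   registers and an unbounded, indirectly addressed memory, both holding
   natural numbers. Every assignment and every test costs one unit of time.
   The only arithmetic is addition and truncated subtraction, so t steps
   lengthen numbers by O(t) bits, and unit cost does not give the machine
   more than polynomial power. *)

Inductive cmd : Type :=
| CConst (x c : nat)
| CAdd (x y z : nat)
| CSub (x y z : nat)
| CRead (x y : nat)
| CWrite (x y : nat)
| CSeq (p q : cmd)
| CIf (x : nat) (p q : cmd)
| CWhile (x : nat) (p : cmd).

Record state : Type := State { reg : nat -> nat; memory : nat -> nat }.

Definition set_reg (s : state) (x v : nat) : state :=
  State [eta reg s with x |-> v] (memory s).

Definition set_mem (s : state) (x v : nat) : state :=
  State (reg s) [eta memory s with x |-> v].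

(* exec p s t s' : started in s, p halts in s' after exactly t units of time. *)
Inductive exec : cmd -> state -> nat -> state -> Prop :=
| exec_Const x c s : exec (CConst x c) s 1 (set_reg s x c)
| exec_Add x y z s :
    exec (CAdd x y z) s 1 (set_reg s x (reg s y + reg s z)%N)
| exec_Sub x y z s :
    exec (CSub x y z) s 1 (set_reg s x (reg s y - reg s z)%N)
| exec_Read x y s : exec (CRead x y) s 1 (set_reg s x (memory s (reg s y)))
| exec_Write x y s : exec (CWrite x y) s 1 (set_mem s (reg s x) (reg s y))
| exec_Seq p q s1 s2 s3 t1 t2 :
    exec p s1 t1 s2 -> exec q s2 t2 s3 -> exec (CSeq p q) s1 (t1 + t2)%N s3
| exec_If_nonzero x p q s t s' :
    reg s x != 0%N -> exec p s t s' -> exec (CIf x p q) s t.+1 s'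
| exec_If_zero x p q s t s' :
    reg s x = 0%N -> exec q s t s' -> exec (CIf x p q) s t.+1 s'
| exec_While_zero x p s : reg s x = 0%N -> exec (CWhile x p) s 1 s
| exec_While_nonzero x p s1 s2 s3 t1 t2 :
    reg s1 x != 0%N -> exec p s1 t1 s2 -> exec (CWhile x p) s2 t2 s3 ->
    exec (CWhile x p) s1 (t1 + t2).+1 s3.

(* Input: the modulus in register 0, k in register 1, and the least nonnegative
   residues of a_0, ..., a_{k-1} in the first k memory cells. *)
Definition input (k n : nat) (a : 'I_k -> 'I_n.+1) : state :=
  State (fun x => if x == 0 then n.+1 else if x == 1 then k else 0)%N
        (fun i => if insub i is Some j then nat_of_ord (a j) else 0%N).

(* Output: memory cell i tells the part of the partition that contains a_i. *)
Definition output_part (k n : nat) (s : state) (a : 'I_k -> 'I_n.+1)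
    (C1 C2 : {set 'I_n.+1}) : Prop :=
  forall i : 'I_k, a i \in (if memory s i == 0%N then C1 else C2).

(* Main.v *)
Require Import Defs.
From HB Require Import structures.
From mathcomp Require Import all_boot all_order all_algebra.
From mathcomp Require Import reals complex cyclic separable cyclotomic.
From mathcomp Require Import ring lra zify.
Set Implicit Arguments.
Unset Strict Implicit.
Unset Printing Implicit Defensive.
Import Order.TTheory GRing.Theory Num.Theory.
Local Open Scope ring_scope.
Import Normc.

(** The partition colours the progression with the Rudin-Shapiro signs
[e_i = +-1], whose partial sums satisfy [|sum_(i < m) e_i z^i| <= 7 sqrt m] at
every point [z] of the unit circle ([rs_poly_le]).

The Laplacians of the circulant graphs on Z_n commute and are diagonalized by
the characters [chi] of Z_n: on the [chi]-component the Laplacian of [X(Z_n, S)]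
acts as half of [sum_(x in S) |1 - chi x|^2].  Hence it is enough to compare,
for each [chi], the signed and the unsigned sum of [|1 - chi x|^2] over the
generating set.  On the progression [a_i = b + i d] one has
[chi a_i = w z^i] with [w = chi b], [z = chi d], and the question is whether
[sqrt k |sum_i e_i |1 - w z^i|^2|] is at most a constant times
[F = sum_i |1 - w z^i|^2] ([rs_chord_sum_le]).

- If [F] is at least a constant times [k], then expanding
  [|1 - w z^i|^2 = 2 - 2 Re (w z^i)] reduces the signed sum to Rudin-Shapiro
  sums at [1] and [z], which are [O(sqrt k)].
- Otherwise all points [w z^i] lie on a short arc near [1].  The points being
  [|1 - z|]-spaced, [F] is then at least a constant times [k^3 |1 - z|^2]
  ([chord_energy_lower]), and this is enough to control the last value and the
  total variation of [i |-> |1 - w z^i|^2] by [F / k].  Summation by parts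
  against the partial sums of [e_i] finishes the case.

A complication is that [a_i = - a_j] may happen for [i <> j]: the two indices
then name the same pair of generators and must receive the same sign.  Each
generator gets the sign of its least index ([pm_index]).  As [a_i + a_j]
depends only on [i + j], and vanishes for at most two values of [i + j]
([card_ap_opposite_sums]), the multiplicity with which [e_i] occurs is [2]
minus the indicators of at most four intervals of indices, so that the bound for
prefixes of the progression is lost only by a factor [10]
([normr_weighted_sum_le]).

The spectral bound is transported to quadratic forms by Parseval's identity
([pm_set_diff_energy]) and to the Loewner order by [rs_class_loewner].  The
machine tabulates the signs by the recursion [e_(2h) = e_h],
[e_(2h+1) = (-1)^h e_h] and finds each least index by linear search, in
quadratic time ([partition_prog_correct]). *)

(** * Rudin-Shapiro signs and their partial sums *)

Lemma normc_sqr (R : rcfType) (z : R[i]) :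
  normc z ^+ 2 = complex.Re z ^+ 2 + complex.Im z ^+ 2.
Proof. by case: z => a b /=; rewrite sqr_sqrtr // addr_ge0 ?sqr_ge0. Qed.

Lemma normc_ge0 (R : rcfType) (z : R[i]) : 0 <= normc z.
Proof. by case: z => a b; apply: sqrtr_ge0. Qed.

Lemma normcX (R : rcfType) (z : R[i]) n : normc (z ^+ n) = normc z ^+ n.
Proof. by elim: n => [|n IHn]; rewrite ?normc1 // !exprS normcM IHn. Qed.

Lemma normc_sign (R : rcfType) (b : bool) : normc ((-1) ^+ b : R[i]) = 1.
Proof. by case: b; rewrite ?expr1 ?normcN normc1. Qed.

Lemma normc_parallelogram (R : rcfType) (x y : R[i]) :
  normc (x + y) ^+ 2 + normc (x - y) ^+ 2 = 2 * (normc x ^+ 2 + normc y ^+ 2).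
Proof. by rewrite !normc_sqr; case: x y => [a b] [c d] /=; ring. Qed.

(** The parity of the number of adjacent pairs of ones in the binary expansion of
[m], provided that the fuel is at least [m]. *)
Fixpoint rudin_shapiro_rec (fuel m : nat) : bool :=
  if fuel is fuel'.+1
  then rudin_shapiro_rec fuel' m./2 (+) (odd m && odd m./2) else false.

Definition rudin_shapiro (m : nat) : bool := rudin_shapiro_rec m m.

Lemma rudin_shapiro_half m :
  rudin_shapiro m = rudin_shapiro m./2 (+) (odd m && odd m./2).
Proof.
have rec0 f : rudin_shapiro_rec f 0 = false by elim: f => //= f ->.
have recE f f' l : (l <= f)%N -> (l <= f')%N ->
    rudin_shapiro_rec f l = rudin_shapiro_rec f' l.
  elim: f f' l => [|f IHf] [|f'] [|l] //= lef lef'; rewrite ?rec0 //.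
  congr (_ (+) _); apply: IHf; lia.
case: m => [|m] //; rewrite {1}/rudin_shapiro [LHS]/=.
by congr (_ (+) _); apply: recE; lia.
Qed.

Lemma rudin_shapiro_double m : rudin_shapiro m.*2 = rudin_shapiro m.
Proof. by rewrite rudin_shapiro_half doubleK odd_double addbF. Qed.

Lemma rudin_shapiro_doubleS m :
  rudin_shapiro m.*2.+1 = rudin_shapiro m (+) odd m.
Proof. by rewrite rudin_shapiro_half /= uphalf_double odd_double. Qed.

Definition rs_sign (R : pzRingType) (i : nat) : R := (-1) ^+ rudin_shapiro i.

Definition rs_poly (R : rcfType) (m : nat) (z : R[i]) : R[i] :=
  \sum_(i < m) rs_sign _ i * z ^+ i.

Lemma rs_polyS (R : rcfType) m (z : R[i]) :
  rs_poly m.+1 z = rs_poly m z + rs_sign _ m * z ^+ m.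
Proof. exact: big_ord_recr. Qed.

(** Splitting the sum into even and odd indices; the sign [(-1)^i] gained at the
index [2i+1] turns the argument [z^2] into [- z^2]. *)
Lemma rs_poly_double (R : rcfType) m (z : R[i]) :
  rs_poly m.*2 z = rs_poly m (z ^+ 2) + z * rs_poly m (- z ^+ 2).
Proof.
elim: m => [|m IHm]; first by rewrite /rs_poly !big_ord0 mulr0 addr0.
rewrite doubleS !rs_polyS IHm mulrDr -!addrA; congr (_ + _).
rewrite addrCA /rs_sign rudin_shapiro_double rudin_shapiro_doubleS.
rewrite -exprM mul2n [(- _) ^+ m]exprNn -exprM mul2n signr_addb signr_odd.
rewrite [z ^+ m.*2.+1]exprS.
by congr (_ + (_ + _)); rewrite -mulrA !(mulrCA z).
Qed.

(** Summing over the pair [z], [- z] is what makes the recursion exact: the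
parallelogram law turns the splitting into even and odd indices into a doubling
of this quantity. *)
Definition rs_energy (R : rcfType) m (z : R[i]) : R :=
  normc (rs_poly m z) ^+ 2 + normc (rs_poly m (- z)) ^+ 2.

Lemma rs_energy_double (R : rcfType) m (z : R[i]) : normc z = 1 ->
  rs_energy m.*2 z = 2 * rs_energy m (z ^+ 2).
Proof.
move=> z1; rewrite /rs_energy !rs_poly_double sqrrN mulNr normc_parallelogram.
by rewrite normcM z1 mul1r.
Qed.

(** One more term changes each of the two norms by at most [1], hence their
Euclidean length by at most [sqrt 2 <= 2]. *)
Lemma rs_energyS (R : rcfType) m (z : R[i]) (x : R) : normc z = 1 -> 0 <= x ->
  rs_energy m z <= x ^+ 2 -> rs_energy m.+1 z <= (x + 2) ^+ 2.
Proof.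
move=> z1 x0; rewrite /rs_energy !rs_polyS.
have step (v w : R[i]) : normc w = 1 ->
    normc (v + rs_sign _ m * w ^+ m) <= normc v + 1.
  move=> w1; apply: le_trans (le_normcD _ _) _.
  by rewrite normcM normc_sign normcX w1 expr1n mulr1.
have := step (rs_poly m z) z z1.
have := step (rs_poly m (- z)) (- z) (etrans (normcN z) z1).
move: (normc_ge0 (rs_poly m z)) (normc_ge0 (rs_poly m (- z))).
move: (normc_ge0 (rs_poly m z + rs_sign _ m * z ^+ m)).
move: (normc_ge0 (rs_poly m (- z) + rs_sign _ m * (- z) ^+ m)).
move: (normc _) (normc _) (normc _) (normc _) => a b c d.
move: (a : R) (b : R) (c : R) (d : R) => {}a {}b {}c {}d.
move=> d0 c0 b0 a0 da cb le_x.
have d2 : d ^+ 2 <= (a + 1) ^+ 2 by rewrite ler_pXn2r // ?nnegrE; lra.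
have c2 : c ^+ 2 <= (b + 1) ^+ 2 by rewrite ler_pXn2r // ?nnegrE; lra.
have : a + b <= 2 * x.
  rewrite -(@ler_pXn2r _ 2%N) ?nnegrE; [|by []|lra|lra].
  have := sqr_ge0 (a - b); nra.
by nra.
Qed.

(** Passing from [m./2] to [m] multiplies the Euclidean length by [sqrt 2] and adds
at most [2].  The correction [- 5] absorbs this additive error, since
[5 sqrt 2 - 2 >= 5], and [7] is large enough to start the induction at [m = 1]. *)
Lemma rs_energy_le (R : rcfType) m (z : R[i]) : (0 < m)%N -> normc z = 1 ->
  rs_energy m z <= (7 * Num.sqrt m%:R - 5) ^+ 2.
Proof.
elim/ltn_ind: m z => m IHm z m_gt0 z1.
have [m1 | m_gt1] := leqP m 1.
  have -> : m = 1%N by lia.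
  rewrite /rs_energy /rs_poly !big_ord_recl !big_ord0 !addr0 !expr0 !mulr1.
  by rewrite normc_sign sqrtr1 expr1n; lra.
have r2 : Num.sqrt 2 ^+ 2 = 2 :> R by rewrite sqr_sqrtr //; lra.
set q := m./2; have q_gt0 : (0 < q)%N by rewrite /q; lia.
have z2 : normc (z ^+ 2) = 1 by rewrite normcX z1 expr1n.
have := IHm q _ (z ^+ 2) q_gt0 z2; rewrite (_ : (q < m)%N); last by rewrite /q; lia.
move=> /(_ isT).
have Eq := rs_energy_double q z1.
have r_ge0 : 0 <= Num.sqrt 2 :> R by apply: sqrtr_ge0.
have s_ge1 : 1 <= Num.sqrt q%:R :> R.
  by rewrite -[leLHS]sqrtr1 ler_wsqrtr // ler1n.
have sqrtD : Num.sqrt q.*2%:R = Num.sqrt 2 * Num.sqrt q%:R :> R.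
  by rewrite -mul2n natrM sqrtrM.
have r_lb : 7 / 5 <= Num.sqrt 2 :> R.
  by rewrite -(@ler_pXn2r _ 2%N) ?nnegrE //; [rewrite r2; lra | lra].
have Em := odd_double_half m; rewrite -/q in Em.
move=> le_q.
have le_2q : rs_energy q.*2 z <= (Num.sqrt 2 * (7 * Num.sqrt q%:R - 5)) ^+ 2.
  by rewrite Eq exprMn r2 ler_pM2l //; lra.
case: (odd m) Em => /= <-; rewrite ?add0n ?add1n; last first.
  apply: le_trans le_2q _.
  rewrite sqrtD ler_pXn2r // ?nnegrE; nra.
have le_sq : Num.sqrt q.*2%:R <= Num.sqrt q.*2.+1%:R :> R.
  by rewrite ler_wsqrtr // ler_nat.
have le1 := rs_energyS z1 _ le_2q; apply: le_trans (le1 _) _; first by nra.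
by rewrite ler_pXn2r // ?nnegrE; nra.
Qed.

Lemma rs_poly_le (R : rcfType) m (z : R[i]) : normc z = 1 ->
  normc (rs_poly m z) <= 7 * Num.sqrt m%:R.
Proof.
case: m => [|m] z1; first by rewrite /rs_poly big_ord0 normc0 sqrtr0 mulr0.
have s_ge1 : 1 <= Num.sqrt m.+1%:R :> R.
  by rewrite -[leLHS]sqrtr1 ler_wsqrtr // ler1n.
have := rs_energy_le (ltn0Sn m) z1; rewrite /rs_energy => le_e.
apply: (@le_trans _ _ (7 * Num.sqrt m.+1%:R - 5)); last by lra.
rewrite -(@ler_pXn2r _ 2%N) ?nnegrE ?normc_ge0 //; last by lra.
by apply: le_trans le_e; rewrite lerDl sqr_ge0.
Qed.

Lemma rs_sign_sum_le (R : rcfType) m :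
  `|\sum_(i < m) rs_sign R i| <= 7 * Num.sqrt m%:R.
Proof.
have := @rs_poly_le R m 1 (normc1 R).
rewrite /rs_poly (eq_bigr (fun i : 'I_m => (rs_sign R i)%:C%C)); last first.
  by move=> i _; rewrite expr1n mulr1 /rs_sign rmorphXn /= rmorphN1.
rewrite -rmorph_sum /=; congr (_ <= _).
by rewrite expr0n addr0 sqrtr_sqr.
Qed.

(** * Chords between 1 and a geometric progression on the circle *)

Definition chord (R : rcfType) (w z : R[i]) (i : nat) : R :=
  normc (1 - w * z ^+ i).

(** For a character [chi], [w = chi b] and [z = chi d], this is the sum of
[|1 - chi a_i|^2] over the progression [a_i = b + i d]. *)
Definition chord_energy (R : rcfType) (k : nat) (w z : R[i]) : R :=
  \sum_(i < k) chord w z i ^+ 2.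

Lemma normc_diff_pow (R : rcfType) (w z : R[i]) i h :
  normc w = 1 -> normc z = 1 ->
  normc (w * z ^+ i - w * z ^+ (i + h)) = normc (1 - z ^+ h).
Proof.
move=> w1 z1; rewrite exprD -mulrBr -[X in _ * (X - _)]mulr1 -mulrBr.
by rewrite !normcM normcX w1 z1 expr1n !mul1r.
Qed.

Lemma normc_subC (R : rcfType) (x y : R[i]) : normc (x - y) = normc (y - x).
Proof. by rewrite -normcN opprB. Qed.

Lemma chord_addn_le (R : rcfType) (w z : R[i]) i h :
  normc w = 1 -> normc z = 1 ->
  `|chord w z i - chord w z (i + h)| <= normc (1 - z ^+ h).
Proof.
move=> w1 z1; rewrite -(normc_diff_pow i h w1 z1) /chord.
set u := w * z ^+ i; set v := w * z ^+ (i + h).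
have uv : normc (1 - u) <= normc (1 - v) + normc (u - v).
  rewrite (_ : 1 - u = (1 - v) + (v - u)); last by ring.
  by rewrite (normc_subC u) le_normcD.
have vu : normc (1 - v) <= normc (1 - u) + normc (u - v).
  by rewrite (_ : 1 - v = (1 - u) + (u - v)) ?le_normcD //; ring.
by rewrite ler_norml; apply/andP; split; lra.
Qed.

Lemma normc_pow_le_chords (R : rcfType) (w z : R[i]) i h :
  normc w = 1 -> normc z = 1 ->
  normc (1 - z ^+ h) <= chord w z i + chord w z (i + h).
Proof.
move=> w1 z1; rewrite -(normc_diff_pow i h w1 z1) /chord.
set u := w * z ^+ i; set v := w * z ^+ (i + h).
rewrite (_ : u - v = (1 - v) + - (1 - u)); last by ring.
by apply: le_trans (le_normcD _ _) _; rewrite normcN addrC.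
Qed.

Lemma normc_pow_linear (R : rcfType) (z : R[i]) h : normc z = 1 ->
  normc (1 - z ^+ h) <= h%:R * normc (1 - z).
Proof.
move=> z1; elim: h => [|h IHh]; first by rewrite expr0 subrr normc0 mul0r.
rewrite (_ : 1 - z ^+ h.+1 = (1 - z ^+ h) + z ^+ h * (1 - z)); last first.
  by rewrite exprSr; ring.
apply: le_trans (le_normcD _ _) _.
by rewrite normcM normcX z1 expr1n mul1r -natr1 mulrDl mul1r lerD2r.
Qed.

(** The quadratic Taylor estimate for [1 - z^h], by induction from
[1 - z^(h+1) = (1 - z^h) + (1 - z) - (1 - z^h) (1 - z)]. *)
Lemma normc_pow_defect (R : rcfType) (z : R[i]) h : normc z = 1 ->
  normc (1 - z ^+ h - h%:R * (1 - z)) <= (h%:R * normc (1 - z)) ^+ 2 / 2.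
Proof.
move=> z1; elim: h => [|h IHh].
  by rewrite expr0 subrr !mul0r subrr normc0 expr0n mul0r.
rewrite (_ : _ - _ = (1 - z ^+ h - h%:R * (1 - z)) + - ((1 - z ^+ h) * (1 - z)));
  last by rewrite exprSr -natr1; ring.
apply: le_trans (le_normcD _ _) _; rewrite normcN normcM.
apply: le_trans (lerD IHh (ler_wpM2r (normc_ge0 _) (normc_pow_linear h z1))) _.
rewrite -[h.+1%:R]natr1; have := sqr_ge0 (normc (1 - z)).
move: (normc (1 - z)) (h%:R : R) => d x; nra.
Qed.

(** As long as [h] steps of length [|1 - z|] stay within distance [1], the chord
keeps a fixed fraction of the length of the path. *)
Lemma normc_pow_lower (R : rcfType) (z : R[i]) h : normc z = 1 ->
  h%:R * normc (1 - z) <= 1 -> h%:R * normc (1 - z) / 2 <= normc (1 - z ^+ h).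
Proof.
move=> z1 small; have hd0 : 0 <= h%:R * normc (1 - z).
  by rewrite mulr_ge0 ?ler0n ?normc_ge0.
have := normc_pow_defect h z1.
have : normc (h%:R * (1 - z)) <=
    normc (1 - z ^+ h) + normc (1 - z ^+ h - h%:R * (1 - z)).
  rewrite [X in normc X <= _](_ : _ =
    (1 - z ^+ h) + - (1 - z ^+ h - h%:R * (1 - z))); last by ring.
  by apply: le_trans (le_normcD _ _) _; rewrite normcN.
have -> : normc (h%:R * (1 - z)) = h%:R * normc (1 - z).
  by rewrite mulr_natl normcMn mulr_natl.
by move: (_ * _) hd0 small => x; nra.
Qed.

(** Two points [h] steps apart cannot both be close to [1], because their mutual
distance is [|1 - z^h|]; adding this over all such pairs uses each index at most
twice. *)
Lemma chord_energy_pairs (R : rcfType) (w z : R[i]) k h :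
  normc w = 1 -> normc z = 1 -> (h <= k)%N ->
  (k - h)%:R * normc (1 - z ^+ h) ^+ 2 <= 4 * chord_energy k w z.
Proof.
move=> w1 z1 le_hk.
have pair i : normc (1 - z ^+ h) ^+ 2 <=
    2 * (chord w z i ^+ 2 + chord w z (i + h) ^+ 2).
  have := normc_pow_le_chords i h w1 z1; have := normc_ge0 (1 - z ^+ h).
  have := sqr_ge0 (chord w z i - chord w z (i + h)).
  move: (chord _ _ _) (chord _ _ _) (normc _) => a b x ab x0 le_x.
  apply: (@le_trans _ _ ((a + b) ^+ 2)); last by nra.
  by rewrite ler_pXn2r // ?nnegrE; lra.
have Fge0 a b : 0 <= \sum_(a <= i < b) chord w z i ^+ 2.
  by apply: sumr_ge0 => i _; apply: sqr_ge0.
have FE : chord_energy k w z = \sum_(0 <= i < k) chord w z i ^+ 2.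
  by rewrite big_mkord.
have lo : \sum_(0 <= i < k - h) chord w z i ^+ 2 <= chord_energy k w z.
  by rewrite FE [leRHS](@big_cat_nat _ _ _ (k - h)) ?leq_subr //= lerDl.
have hi : \sum_(0 <= i < k - h) chord w z (i + h) ^+ 2 <= chord_energy k w z.
  rewrite FE [leRHS](@big_cat_nat _ _ _ h) //=.
  by rewrite -[in leRHS](add0n h) big_addn add0n lerDr.
have := @ler_sum_nat _ 0%N (k - h)%N (fun=> normc (1 - z ^+ h) ^+ 2) _
  (fun i _ => pair i).
rewrite sumr_const_nat subn0 -mulr_sumr big_split /=.
by move=> H; rewrite mulr_natl; apply: le_trans H _; lra.
Qed.

(** Pairing at a distance [h <= k / 2].  If [k |1 - z| <= 2], the choice [h = k / 2]
gives [|1 - z^h|] of order [k |1 - z|].  Otherwise the least [h] with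
[h |1 - z| >= 1/2] is at most [k / 2] and gives [|1 - z^h| >= 1/4]. *)
Lemma chord_energy_lower (R : rcfType) (w z : R[i]) k :
  normc w = 1 -> normc z = 1 -> (1 < k)%N ->
  k%:R / 128 <= chord_energy k w z \/
  k%:R ^+ 3 * normc (1 - z) ^+ 2 / 288 <= chord_energy k w z.
Proof.
move=> w1 z1 k_gt1; set d := normc (1 - z).
have d0 : 0 <= d by apply: normc_ge0.
have pairs h : (h <= k./2)%N -> k%:R / 2 * normc (1 - z ^+ h) ^+ 2
     <= 4 * chord_energy k w z.
  move=> le_h; apply: le_trans (chord_energy_pairs w1 z1 (_ : h <= k)%N); last lia.
  rewrite ler_wpM2r ?sqr_ge0 //.
  have : (k <= 2 * (k - h))%N by lia.
  by rewrite -(ler_nat R) natrM; lra.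
have half_ub : (k./2)%:R * 2 <= k%:R :> R.
  by rewrite -natrM ler_nat; lia.
have half_lb : k%:R <= (k./2)%:R * 3 :> R.
  by rewrite -natrM ler_nat; lia.
have k0 : 0 <= k%:R :> R by [].
have [small|big] := lerP (k%:R * d) 2.
  right; have := pairs _ (leqnn _).
  have hd : (k./2)%:R * d <= 1 by nra.
  have := normc_pow_lower z1 hd; rewrite -/d.
  have : k%:R * d / 6 <= (k./2)%:R * d / 2 by nra.
  move: (normc (1 - _)) => y le1 le2 le3.
  have kd0 : 0 <= k%:R * d by rewrite mulr_ge0.
  have : (k%:R * d / 6) ^+ 2 <= y ^+ 2 by rewrite ler_pXn2r // ?nnegrE; lra.
  move=> /(ler_wpM2l (_ : 0 <= k%:R / 2)) le4.
  have := le_trans (le4 _) le3; rewrite !exprMn; lra.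
left.
have ex_h : exists h, 1 / 2 <= h%:R * d.
  by exists k./2; nra.
have [h hP h_min] := ex_minnP ex_h.
have le_h : (h <= k./2)%N by apply: h_min; nra.
have := pairs h le_h; suff : 1 / 4 <= normc (1 - z ^+ h).
  move: (normc _) => y le1 le2.
  have : (1 / 4) ^+ 2 <= y ^+ 2 by rewrite ler_pXn2r // ?nnegrE; lra.
  by move: (y ^+ 2) le2 => Y; nra.
have h_gt0 : (0 < h)%N.
  by rewrite lt0n; apply/eqP => h0; move: hP; rewrite h0; lra.
have : ~~ (1 / 2 <= h.-1%:R * d) by apply/negP => /h_min; lia.
rewrite -ltNge => lt_h1.
have Eh : h%:R = h.-1%:R + 1 :> R by rewrite natr1 prednK.
have [hd|hd] := lerP (h%:R * d) 1.
  by have := normc_pow_lower z1 hd; rewrite -/d; lra.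
have h1 : h = 1%N.
  apply/eqP; rewrite eqn_leq h_gt0 andbT leqNgt; apply/negP => h_gt1.
  have : 1 <= h.-1%:R :> R by rewrite ler1n; lia.
  nra.
by move: hd; rewrite h1 expr1 -/d; lra.
Qed.

Lemma abel_sum (R : comPzRingType) (e f : nat -> R) m :
  \sum_(i < m.+1) e i * f i =
  (\sum_(i < m.+1) e i) * f m +
  \sum_(i < m) (\sum_(j < i.+1) e j) * (f i - f i.+1).
Proof.
elim: m => [|m IHm]; first by rewrite !big_ord_recr !big_ord0 /= !add0r addr0.
rewrite big_ord_recr IHm /= [in RHS]big_ord_recr [\sum_(i < m.+1) (_ * _)]big_ord_recr.
by rewrite /=; ring.
Qed.

Lemma abel_sum_le (R : realDomainType) (e f : nat -> R) m (M : R) :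
  (forall j, (j <= m.+1)%N -> `|\sum_(i < j) e i| <= M) ->
  `|\sum_(i < m.+1) e i * f i| <= M * (`|f m| + \sum_(i < m) `|f i - f i.+1|).
Proof.
move=> eM; rewrite abel_sum mulrDr.
apply: le_trans (ler_normD _ _) _; apply: lerD.
  by rewrite normrM ler_wpM2r // eM.
apply: le_trans (ler_norm_sum _ _ _) _; rewrite mulr_sumr.
apply: ler_sum => i _; rewrite normrM ler_wpM2r // eM //.
by have := ltn_ord i; lia.
Qed.

Lemma chord_sqr (R : rcfType) (w z : R[i]) i : normc w = 1 -> normc z = 1 ->
  chord w z i ^+ 2 = 2 - 2 * complex.Re (w * z ^+ i).
Proof.
move=> w1 z1; have u1 : normc (w * z ^+ i) = 1.
  by rewrite normcM normcX w1 z1 expr1n mulr1.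
move: u1; rewrite /chord => /(congr1 (fun x => x ^+ 2)).
rewrite !normc_sqr expr1n; case: (w * _) => a b /=; nra.
Qed.

Lemma normr_Re_le (R : rcfType) (x : R[i]) : `|complex.Re x| <= normc x.
Proof.
rewrite -(@ler_pXn2r _ 2%N) ?nnegrE ?normc_ge0 //.
by rewrite normc_sqr real_normK ?num_real // lerDl sqr_ge0.
Qed.

(** Expanding [|1 - w z^i|^2 = 2 - 2 Re (w z^i)] leaves Rudin-Shapiro sums at [1]
and at [z]. *)
Lemma rs_chord_sum_trivial (R : rcfType) (w z : R[i]) m :
  normc w = 1 -> normc z = 1 ->
  `|\sum_(i < m) rs_sign R i * chord w z i ^+ 2| <= 28 * Num.sqrt m%:R.
Proof.
move=> w1 z1; have -> : \sum_(i < m) rs_sign R i * chord w z i ^+ 2 =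
    2 * (\sum_(i < m) rs_sign R i) - 2 * complex.Re (w * rs_poly m z).
  elim: m => [|m IHm].
    by rewrite /rs_poly !big_ord0 !mulr0 subrr.
  rewrite !big_ord_recr rs_polyS IHm /= chord_sqr // [w * (_ + _)]mulrDr.
  rewrite [w * (rs_sign _ m * _)]mulrCA /rs_sign.
  move: (w * rs_poly m z) (w * z ^+ m) => [a b] [c e].
  by case: (rudin_shapiro m); rewrite ?expr0 ?expr1 ?mulN1r ?mul1r /=; ring.
have := rs_sign_sum_le R m; have := rs_poly_le m z1.
have := normr_Re_le (w * rs_poly m z); rewrite normcM w1 mul1r.
move: (complex.Re _) (normc _) (\sum_(_ < _) _) (Num.sqrt _) => a b c s.
move: (a : R) (b : R) (c : R) (s : R) => {}a {}b {}c {}s.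
rewrite !ler_norml => /andP[a1 a2] bs /andP[c1 c2].
by apply/andP; split; lra.
Qed.

(** Summation by parts.  With [g_i = |1 - w z^i|] and [d = |1 - z|], consecutive
values satisfy [|g_i^2 - g_(i+1)^2| <= d (g_i + g_(i+1))], and by the
arithmetic-geometric inequality [k] times the total variation is at most
[k^3 d^2 + F]; likewise [k g_m^2 <= 2 (k^3 d^2 + F)].  The constant is
[6069 = 7 (2 * 289 + 289)]. *)
Lemma rs_chord_sum_abel (R : rcfType) (w z : R[i]) k m :
  normc w = 1 -> normc z = 1 -> (m < k)%N ->
  k%:R ^+ 3 * normc (1 - z) ^+ 2 <= 288 * chord_energy k w z ->
  Num.sqrt k%:R * `|\sum_(i < m.+1) rs_sign R i * chord w z i ^+ 2|
    <= 6069 * chord_energy k w z.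
Proof.
move=> w1 z1 lt_mk; set d := normc (1 - z); set F := chord_energy k w z => dF.
have d0 : 0 <= d by apply: normc_ge0.
have g0 i : 0 <= chord w z i by apply: normc_ge0.
have k_gt0 : (0 < k)%N by lia.
have FE x : \sum_(i < k) (x + chord w z i ^+ 2) = k%:R * x + F.
  by rewrite big_split sumr_const card_ord mulr_natl.
have near i : (i < k)%N -> chord w z m ^+ 2 <=
    2 * ((k%:R * d) ^+ 2 + chord w z i ^+ 2).
  move=> lt_ik; suff : chord w z m <= k%:R * d + chord w z i.
    have := g0 m; have := g0 i; have : 0 <= k%:R * d by rewrite mulr_ge0.
    move: (chord _ _ _) (chord _ _ _) (_ * _) => a b c c0 b0 a0 le_a.
    apply: (@le_trans _ _ ((c + b) ^+ 2)); last by have := sqr_ge0 (c - b); nra.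
    by rewrite ler_pXn2r ?nnegrE // addr_ge0.
  have lip h : (h <= k)%N -> normc (1 - z ^+ h) <= k%:R * d.
    move=> le_hk; apply: le_trans (normc_pow_linear h z1) _.
    by rewrite ler_wpM2r // ler_nat.
  have [le_im|lt_mi] := leqP i m.
    have := chord_addn_le i (m - i) w1 z1; rewrite subnKC // ler_norml.
    by have := lip (m - i)%N; rewrite (_ : (_ <= _)%N); [move=> /(_ isT); lra|lia].
  have := chord_addn_le m (i - m) w1 z1; rewrite subnKC ?(ltnW lt_mi) // ler_norml.
  by have := lip (i - m)%N; rewrite (_ : (_ <= _)%N); [move=> /(_ isT); lra|lia].
have last_le : k%:R * chord w z m ^+ 2 <= 578 * F.
  apply: (@le_trans _ _ (2 * (k%:R * (k%:R * d) ^+ 2 + F))).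
    rewrite -FE mulr_sumr mulr_natl -[X in _ *+ X <= _]card_ord -sumr_const.
    by apply: ler_sum => i _; apply: near.
  by rewrite (_ : k%:R * (k%:R * d) ^+ 2 = k%:R ^+ 3 * d ^+ 2); [lra|ring].
have var_le : k%:R * (\sum_(i < m) `|chord w z i ^+ 2 - chord w z i.+1 ^+ 2|)
    <= 289 * F.
  have step i : k%:R * `|chord w z i ^+ 2 - chord w z i.+1 ^+ 2| <=
      ((k%:R * d) ^+ 2 + chord w z i ^+ 2) / 2 +
      ((k%:R * d) ^+ 2 + chord w z i.+1 ^+ 2) / 2.
    rewrite subr_sqr normrM (ger0_norm (addr_ge0 (g0 i) (g0 i.+1))).
    have := chord_addn_le i 1 w1 z1; rewrite addn1 expr1 -/d.
    have := g0 i; have := g0 i.+1; have : 0 <= k%:R :> R by [].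
    have := normr_ge0 (chord w z i - chord w z i.+1).
    move: (chord _ _ _) (chord _ _ _) `|_| => a b c c0.
    move: (k%:R : R) => K K0 b0 a0 le_c.
    apply: (@le_trans _ _ (K * (d * (a + b)))).
      by rewrite ler_wpM2l // ler_wpM2r // addr_ge0.
    have := sqr_ge0 (K * d - a); have := sqr_ge0 (K * d - b); nra.
  have sub_le j : (j + m <= k)%N ->
      \sum_(i < m) ((k%:R * d) ^+ 2 + chord w z (j + i) ^+ 2)
      <= k%:R * (k%:R * d) ^+ 2 + F.
    move=> le_jmk; rewrite -FE.
    rewrite -(big_mkord xpredT (fun i => (k%:R * d) ^+ 2 + chord w z (j + i) ^+ 2)).
    rewrite -(big_mkord xpredT (fun i => (k%:R * d) ^+ 2 + chord w z i ^+ 2)).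
    rewrite [leRHS](@big_cat_nat _ _ _ j) //=; last lia.
    rewrite [X in _ <= _ + X](@big_cat_nat _ _ _ (j + m)%N) ?leq_addr //=.
    have shift (G : nat -> R) :
        \sum_(j <= i < j + m) G i = \sum_(0 <= i < m) G (j + i)%N.
      rewrite -[X in \sum_(X <= _ < _) _]add0n big_addn addKn.
      by apply: eq_bigr => i _; rewrite addnC.
    rewrite shift.
    rewrite addrCA lerDl addr_ge0 // sumr_ge0 // => i _;
    by rewrite addr_ge0 // sqr_ge0.
  rewrite mulr_sumr; apply: le_trans; first by apply: ler_sum => i _; exact: step.
  rewrite big_split /= -!mulr_suml.
  have sub0 : \sum_(i < m) ((k%:R * d) ^+ 2 + chord w z i ^+ 2) <= _ :=
    sub_le 0%N (ltnW lt_mk).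
  have sub1 : \sum_(i < m) ((k%:R * d) ^+ 2 + chord w z i.+1 ^+ 2) <= _ :=
    sub_le 1%N lt_mk.
  move: sub0 sub1.
  rewrite (_ : k%:R * (k%:R * d) ^+ 2 = k%:R ^+ 3 * d ^+ 2); last by ring.
  by lra.
have M j : (j <= m.+1)%N -> `|\sum_(i < j) rs_sign R i| <= 7 * Num.sqrt k%:R.
  move=> le_jm; apply: le_trans (rs_sign_sum_le R j) _.
  by rewrite ler_pM2l // ler_wsqrtr // ler_nat; lia.
have := abel_sum_le (fun i => chord w z i ^+ 2) M.
move=> /(ler_wpM2l (sqrtr_ge0 k%:R)) le_abel; apply: le_trans le_abel _.
rewrite mulrA mulrCA -expr2 sqr_sqrtr // ger0_norm ?sqr_ge0 //.
by rewrite -mulrA mulrDr; lra.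
Qed.

Lemma rs_chord_sum_le (R : rcfType) (w z : R[i]) k m :
  normc w = 1 -> normc z = 1 -> (m <= k)%N ->
  Num.sqrt k%:R * `|\sum_(i < m) rs_sign R i * chord w z i ^+ 2|
    <= 6069 * chord_energy k w z.
Proof.
move=> w1 z1; case: m => [|m] lt_mk.
  rewrite big_ord0 normr0 mulr0 mulr_ge0 // sumr_ge0 // => i _; exact: sqr_ge0.
have [k_le1|k_gt1] := leqP k 1.
  have -> : k = 1%N by lia.
  have -> : m = 0%N by lia.
  rewrite /chord_energy !big_ord_recr !big_ord0 /= !add0r sqrtr1 mul1r normrM.
  rewrite /rs_sign normrX normrN1 expr1n mul1r ger0_norm ?sqr_ge0 //.
  by have := sqr_ge0 (chord w z 0); lra.
have [big|spread] := chord_energy_lower w1 z1 k_gt1; last first.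
  by apply: rs_chord_sum_abel => //; lra.
have le_28 := rs_chord_sum_trivial m.+1 w1 z1.
have k0 : 0 <= k%:R :> R by [].
apply: (@le_trans _ _ (28 * k%:R)); last by lra.
have -> : 28 * k%:R = Num.sqrt k%:R * (28 * Num.sqrt k%:R) :> R.
  by rewrite mulrCA -expr2 sqr_sqrtr.
rewrite ler_wpM2l ?sqrtr_ge0 //; apply: le_trans le_28 _.
by rewrite ler_pM2l // ler_wsqrtr // ler_nat.
Qed.

(** * Generators named by two indices *)

(** A generator is coloured by this index.  It is even in [x], so the colour classes
are symmetric, and two indices naming the same pair of generators agree.  Its
value is [k] outside the generating set. *)
Definition pm_index (k n : nat) (a : 'I_k -> 'I_n.+1) (x : 'I_n.+1) : nat :=
  find (fun j => (a j == x) || (a j == - x)) (enum 'I_k).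

Lemma pm_indexN (k n : nat) (a : 'I_k -> 'I_n.+1) x :
  pm_index a (- x) = pm_index a x.
Proof. by apply: eq_find => j; rewrite opprK orbC. Qed.

Lemma pm_index_le (k n : nat) (a : 'I_k -> 'I_n.+1) x (j : 'I_k) :
  (a j == x) || (a j == - x) -> (pm_index a x <= j)%N.
Proof.
move=> aj; rewrite leqNgt; apply/negP => /(before_find j).
by rewrite nth_ord_enum aj.
Qed.

Lemma pm_index_mem (k n : nat) (a : 'I_k -> 'I_n.+1) x (j : 'I_k) :
  pm_index a x = j -> (a j == x) || (a j == - x).
Proof.
move=> E; have /(nth_find j) : has (fun j => (a j == x) || (a j == - x)) (enum 'I_k).
  by rewrite has_find -[X in (X < _)%N]/(pm_index a x) E size_enum_ord.
by rewrite -[find _ _]/(pm_index a x) E nth_ord_enum.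
Qed.

Lemma pm_index_lt (k n : nat) (a : 'I_k -> 'I_n.+1) x :
  (pm_index a x < k)%N = (x \in pm_set a).
Proof.
rewrite inE; apply/idP/existsP => [lt_k | [j]].
  exists (Ordinal lt_k); have := @pm_index_mem _ _ a x (Ordinal lt_k) erefl.
  by rewrite ![a _ == _]eq_sym eqr_oppLR.
rewrite ![x == _]eq_sym eqr_oppLR => aj.
exact: leq_ltn_trans (pm_index_le aj) (ltn_ord j).
Qed.

(** The number of generators coloured by the index [i]: normally the two elements
[a_i] and [- a_i], only one if they coincide, and none if an earlier index [j]
has [a_j = - a_i].  The form chosen for the correction term sees the pair
[(i, j)] only through [a_i + a_j] and the order of [i] and [j]. *)
Lemma card_pm_index (k n : nat) (a : 'I_k -> 'I_n.+1) (i : 'I_k) :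
  injective a ->
  (#|[set x | pm_index a x == i]| +
   \sum_(j < k) (a i + a j == 0)%R * ((j < i) + (j <= i)) = 2)%N.
Proof.
move=> a_inj; set S := [set x | _].
have neg_eq (j : 'I_k) : (a i + a j == 0) = (a j == - a i).
  by rewrite addrC addr_eq0.
have S_eq : S = if pm_index a (a i) == i then [set a i; - a i] else set0.
  apply/setP => x; rewrite inE; case: ifP => [/eqP Ei|Ei]; last first.
    rewrite inE; apply/negP => /eqP Ex; have := pm_index_mem Ex.
    by case/orP => /eqP E; move: Ei; rewrite E ?pm_indexN Ex eqxx.
  rewrite !inE; apply/eqP/idP => [Ex|]; last first.
    by case/orP => /eqP ->; rewrite ?pm_indexN.
  by have := pm_index_mem Ex; rewrite ![x == _]eq_sym eqr_oppLR.
have index_le : (pm_index a (a i) <= i)%N by apply: pm_index_le; rewrite eqxx.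
(* By injectivity at most one [j] has [a_j = - a_i]; what counts is whether it
   comes before, at or after [i]. *)
have [j aj|no_j] := pickP (fun j => a j == - a i); last first.
  rewrite big1 => [|j _]; last by rewrite neg_eq no_j.
  rewrite addn0 S_eq (_ : pm_index _ _ == i).
    by rewrite cards2 no_j.
  rewrite eqn_leq index_le leqNgt; apply/negP => lt_i.
  have := @pm_index_mem _ _ a (a i) (Ordinal (ltn_trans lt_i (ltn_ord i))) erefl.
  by rewrite no_j orbF => /eqP /a_inj /(congr1 val) /= E; rewrite E ltnn in lt_i.
rewrite (bigD1 j) //= big1 => [|j' ne_j]; last first.
  rewrite neg_eq -(eqP aj) (inj_eq a_inj) (negbTE ne_j) //.
rewrite neg_eq aj mul1n addn0.
have [lt_ji|lt_ij|Eij] := ltngtP j i.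
- rewrite S_eq; case: eqP => [E|_]; last by rewrite cards0.
  by have := @pm_index_le _ _ a (a i) j; rewrite aj orbT E leqNgt lt_ji => /(_ isT).
- rewrite addn0 S_eq (_ : pm_index _ _ == i).
    by rewrite cards2 -(eqP aj) (inj_eq a_inj) -val_eqE /= neq_ltn lt_ij.
  rewrite eqn_leq index_le leqNgt; apply/negP => lt_i.
  have := @pm_index_mem _ _ a (a i) (Ordinal (ltn_trans lt_i (ltn_ord i))) erefl.
  case/orP => [/eqP /a_inj /(congr1 val) /= E|]; first by rewrite E ltnn in lt_i.
  rewrite -(eqP aj) => /eqP /a_inj /(congr1 val) /= E.
  by move: lt_i; rewrite E ltnNge (ltnW lt_ij).
- have {}Eij : j = i by apply: val_inj.
  rewrite Eij in aj; rewrite S_eq (_ : pm_index _ _ == i).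
    by rewrite -(eqP aj) cards2 eqxx.
  rewrite eqn_leq index_le leqNgt; apply/negP => lt_i.
  have := @pm_index_mem _ _ a (a i) (Ordinal (ltn_trans lt_i (ltn_ord i))) erefl.
  by rewrite -(eqP aj) orbb => /eqP /a_inj /(congr1 val) /= E; rewrite E ltnn in lt_i.
Qed.

Lemma sum_pm_set_index (R : pzRingType) (k n : nat) (a : 'I_k -> 'I_n.+1)
    (e : nat -> R) (f : 'I_n.+1 -> R) :
  (forall x, f (- x) = f x) ->
  \sum_(x in pm_set a) e (pm_index a x) * f x =
  \sum_(i < k) e i * f (a i) * #|[set x | pm_index a x == i]|%:R.
Proof.
move=> f_even; case: k a => [|k] a.
  rewrite big_ord0 big1 // => x; rewrite inE => /existsP[[]] //.
rewrite (partition_big (fun x => inord (pm_index a x) : 'I_k.+1) xpredT) //=.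
apply: eq_bigr => i _; rewrite mulr_natr -sumr_const big_mkcond [RHS]big_mkcond.
apply: eq_bigr => x _; rewrite -pm_index_lt inE -val_eqE /=.
have [lt_k|ge_k] := ltnP (pm_index a x) k.+1; last first.
  by rewrite /=; case: eqP => // E; have := ltn_ord i; lia.
rewrite inordK //; case: eqP => // E; rewrite E.
by have := pm_index_mem E; case/orP => /eqP ->; rewrite ?f_even.
Qed.

Lemma sum_window (R : pzRingType) (h : nat -> R) k lo hi : (lo <= hi)%N ->
  \sum_(i < k) h i * (lo <= i < hi)%:R =
  \sum_(i < minn hi k) h i - \sum_(i < minn lo k) h i.
Proof.
move=> le_lohi.
have below m : \sum_(i < k) h i * (i < m)%:R = \sum_(i < minn m k) h i.
  elim: k => [|k IHk]; first by rewrite minn0 !big_ord0.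
  rewrite big_ord_recr IHk /=; have [le_mk|lt_km] := leqP m k.
    by rewrite mulr0 addr0 (minn_idPl (leqW le_mk)).
  by rewrite mulr1 (minn_idPr lt_km) big_ord_recr.
rewrite -!below -sumrB; apply: eq_bigr => i _; rewrite -mulrBr; congr (_ * _).
have [le_lo|lt_lo] := leqP lo i; first by rewrite /= subr0.
by rewrite /= (leq_trans lt_lo le_lohi) subrr.
Qed.

(** Reindexing by [s = i + j]: for a fixed [s], the indices [i] that matter form the
intervals given by [i <= s < 2 i] and [i <= s <= 2 i]. *)
Lemma sum_by_index_sum (e : nat -> nat) k (i : nat) : (i < k)%N ->
  (\sum_(j < k) e (i + j) * ((j < i) + (j <= i)) =
   \sum_(s < k.*2) e s * ((i <= s < i.*2) + (i <= s <= i.*2)))%N.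
Proof.
move=> lt_ik.
rewrite -(big_mkord xpredT (fun j => e (i + j) * ((j < i) + (j <= i))))%N.
rewrite -(big_mkord xpredT (fun s => e s * ((i <= s < i.*2) + (i <= s <= i.*2))))%N.
rewrite [RHS](@big_cat_nat _ _ _ i) //=; last lia.
rewrite [X in _ = (X + _)%N]big_nat_cond [X in _ = (X + _)%N]big1 => [|s]; last first.
  by rewrite andbT => /andP[_ lt_si]; rewrite leqNgt lt_si muln0.
rewrite add0n -[X in _ = \sum_(X <= _ < _) _]add0n big_addn.
rewrite [RHS](@big_cat_nat _ _ _ k) //=; last lia.
rewrite [X in _ = (_ + X)%N]big_nat_cond [X in _ = (_ + X)%N]big1 => [|j]; last first.
  rewrite andbT => /andP[le_kj _].
  by rewrite (_ : (j + i < i.*2)%N = false) 1?(_ : (j + i <= i.*2)%N = false);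
    rewrite ?andbF ?muln0 //; lia.
rewrite addn0; apply: eq_bigr => j _; rewrite leq_addl addnC -addnn.
by rewrite !leq_add2r ltn_add2r.
Qed.

(** Each interval sum is a difference of two prefix sums, hence at most [2 B]; each of
the at most two values of [s] contributes two intervals, and the main term
contributes [2 B]. *)
Lemma normr_weighted_sum_le (R : realDomainType) (h : nat -> R) (B : R)
    (k : nat) (e : nat -> bool) :
  (forall m, (m <= k)%N -> `|\sum_(i < m) h i| <= B) ->
  (\sum_(s < k.*2) e s <= 2)%N ->
  `|\sum_(i < k) h i *
     (2 - (\sum_(j < k) e (i + j)%N * ((j < i) + (j <= i)))%:R)| <= 10 * B.
Proof.
move=> hB e2; have B0 : 0 <= B.
  by apply: le_trans (hB 0%N (leq0n _)); apply: normr_ge0.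
have window lo hi : (lo <= hi)%N ->
    `|\sum_(i < k) h i * (lo <= i < hi)%:R| <= 2 * B.
  move=> le_lohi; rewrite sum_window //; apply: le_trans (ler_normB _ _) _.
  have := hB _ (geq_minr hi k); have := hB _ (geq_minr lo k).
  by move: `|_| `|_| => x y; lra.
(* The windows [i <= s < 2 i] and [i <= s <= 2 i], written as ranges of [i]. *)
pose W s : R := \sum_(i < k) h i * (s./2.+1 <= i < s.+1)%:R +
                \sum_(i < k) h i * (uphalf s <= i < s.+1)%:R.
have W_le s : `|W s| <= 4 * B.
  apply: le_trans (ler_normD _ _) _.
  have := @window (s./2.+1) s.+1 (_ : _ <= _)%N; rewrite (_ : (_ <= _)%N); last lia.
  have := @window (uphalf s) s.+1 (_ : _ <= _)%N; rewrite (_ : (_ <= _)%N); last lia.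
  by move=> /(_ isT) + /(_ isT); move: `|_| `|_| => x y; lra.
have -> : \sum_(i < k) h i *
     (2 - (\sum_(j < k) e (i + j)%N * ((j < i) + (j <= i)))%:R) =
    2 * (\sum_(i < k) h i) - \sum_(s < k.*2) (e s)%:R * W s.
  transitivity (2 * (\sum_(i < k) h i) - \sum_(i < k) \sum_(s < k.*2)
     (e s)%:R * (h i * (s./2.+1 <= i < s.+1)%:R + h i * (uphalf s <= i < s.+1)%:R)).
    rewrite mulr_sumr -sumrB; apply: eq_bigr => i _.
    rewrite mulrBr mulrC (@sum_by_index_sum (fun s => e s)) //; congr (_ - _).
    rewrite natr_sum mulr_sumr; apply: eq_bigr => s _.
    rewrite natrM natrD mulrCA mulrDr; congr (_ * (_ * _%:R + _ * _%:R)).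
      by congr (nat_of_bool _); lia.
    by congr (nat_of_bool _); lia.
  rewrite exchange_big /=; congr (_ - _); apply: eq_bigr => s _.
  by rewrite -mulr_sumr big_split.
apply: le_trans (ler_normB _ _) _; rewrite normrM ger0_norm //.
have le_sum : `|\sum_(s < k.*2) (e s)%:R * W s| <= 2 * (4 * B).
  apply: le_trans (ler_norm_sum _ _ _) _.
  apply: (@le_trans _ _ (\sum_(s < k.*2) (e s)%:R * (4 * B))).
    apply: ler_sum => s _; rewrite normrM ger0_norm ?ler0n //.
    by rewrite ler_wpM2l ?ler0n.
  rewrite -mulr_suml -natr_sum ler_wpM2r ?mulr_ge0 //.
  by rewrite ler_nat.
by have := hB k (leqnn _); move: `|_| le_sum `|_| => x le_x y le_y; lra.
Qed.

(** Two such values of [s] less than [k] apart would give a multiple [d *+ h = 0] with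
[0 < h < k], against injectivity.  So each half of [[0, 2k)] contains at most one. *)
Lemma card_ap_opposite_sums (k n : nat) (a : 'I_k -> 'I_n.+1) (b d : 'I_n.+1) :
  (forall i, a i = b + d *+ i) -> injective a ->
  (\sum_(s < k.*2) (b *+ 2 + d *+ s == 0)%R <= 2)%N.
Proof.
move=> aE a_inj.
rewrite (_ : \sum_(s < _) _ = #|[set s : 'I_k.*2 | (b *+ 2 + d *+ s == 0)%R]|)%N;
  last by rewrite -sum1dep_card [RHS]big_mkcond; apply: eq_bigr => s _; case: eqP.
rewrite -card_bool; apply: (leq_card_in (fun s : 'I_k.*2 => k <= s)%N) => s s'.
wlog le_ss : s s' / (s <= s')%N.
  move=> H s_in s'_in same; have [/H -> //|/ltnW /H] := leqP s s'.
  by move=> /(_ s'_in s_in (esym same)).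
rewrite !inE => /eqP s0 /eqP s'0 /= same.
have [lt_ss|?] := ltnP s s'; last by apply: ord_inj; lia.
have lt_k : (s' - s < k)%N.
  move: same (ltn_ord s) (ltn_ord s').
  by case: (leqP k s) => ?; case: (leqP k s') => ?; lia.
have k_gt0 : (0 < k)%N by lia.
have : a (Ordinal lt_k) = a (Ordinal k_gt0).
  rewrite !aE /= mulr0n; congr (_ + _).
  move: s'0; rewrite -(subnKC le_ss) mulrnDr addrA s0 add0r addKn.
  by [].
by move=> /a_inj /(congr1 val) /=; lia.
Qed.

(** The bound for prefixes of the progression, applied with [w = chi b] and
[z = chi d].  On the right, the unsigned sum over the progression is at most
that over the whole generating set, as it counts each generator at most once. *)
Lemma pm_set_discrepancy (R : rcfType) (k n : nat) (a : 'I_k -> 'I_n.+1)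
    (chi : 'I_n.+1 -> R[i]) :
  (forall x y, chi (x + y) = chi x * chi y) -> (forall x, normc (chi x) = 1) ->
  arith_progression a -> injective a ->
  Num.sqrt k%:R *
    `|\sum_(x in pm_set a) rs_sign R (pm_index a x) * normc (1 - chi x) ^+ 2|
  <= (10 * 6069) * \sum_(x in pm_set a) normc (1 - chi x) ^+ 2.
Proof.
move=> chiD chi1 [b [d aE]] a_inj.
have chi_neq0 x : chi x != 0.
  by apply/eqP => E; have := chi1 x; rewrite E normc0 => /eqP; rewrite eq_sym oner_eq0.
have chi0 : chi 0 = 1.
  by apply: (mulfI (chi_neq0 0)); rewrite -chiD addr0 mulr1.
have chiX x m : chi (x *+ m) = chi x ^+ m.
  by elim: m => [|m IHm]; rewrite ?mulr0n // mulrS exprS chiD IHm.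
have even x : normc (1 - chi (- x)) ^+ 2 = normc (1 - chi x) ^+ 2.
  rewrite -[normc (1 - chi x)]mul1r -(chi1 (- x)) -normcM mulrBr mulr1 -chiD.
  by rewrite addNr chi0 normc_subC.
have chordE (i : 'I_k) : normc (1 - chi (a i)) = chord (chi b) (chi d) i.
  by rewrite aE chiD chiX.
pose h i := rs_sign R i * chord (chi b) (chi d) i ^+ 2.
have H : Num.sqrt k%:R * `|\sum_(x in pm_set a) rs_sign R (pm_index a x) *
    normc (1 - chi x) ^+ 2| <= (10 * 6069) * chord_energy k (chi b) (chi d).
  rewrite (sum_pm_set_index a (rs_sign R) even).
  have countE (i : 'I_k) : #|[set x | pm_index a x == i]|%:R = 2 -
      (\sum_(j < k) (b *+ 2 + d *+ (i + j)%N == 0)%R * ((j < i) + (j <= i)))%:R :> R.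
    apply/eqP; rewrite eq_sym subr_eq -natrD.
    have <- : (\sum_(j < k) (a i + a j == 0)%R * ((j < i) + (j <= i)) =
        \sum_(j < k) (b *+ 2 + d *+ (i + j)%N == 0)%R * ((j < i) + (j <= i)))%N.
      by apply: eq_bigr => j _; rewrite !aE addrACA -mulrnDr -mulr2n.
    by rewrite (card_pm_index i a_inj).
  under eq_bigr => i _ do rewrite countE chordE -/(h i).
  set K : R := Num.sqrt k%:R.
  have [K0|K_gt0] := eqVneq K 0.
    by rewrite K0 mul0r !mulr_ge0 // sumr_ge0 // => i _; apply: sqr_ge0.
  have {}K_gt0 : 0 < K by rewrite lt_neqAle eq_sym K_gt0 sqrtr_ge0.
  have hB m : (m <= k)%N ->
      `|\sum_(i < m) h i| <= 6069 * chord_energy k (chi b) (chi d) / K.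
    by move=> le_mk; rewrite ler_pdivlMr // mulrC; apply: rs_chord_sum_le.
  rewrite mulrC -ler_pdivlMr // -!mulrA [6069 * _]mulrA.
  apply: (normr_weighted_sum_le (e := fun s => b *+ 2 + d *+ s == 0) hB).
  exact: (card_ap_opposite_sums aE a_inj).
apply: le_trans H _; rewrite ler_pM2l ?mulr_gt0 // /chord_energy.
rewrite (eq_bigr (fun i => normc (1 - chi (a i)) ^+ 2)) => [|i _]; last first.
  by rewrite chordE.
rewrite -(big_imset (fun x => normc (1 - chi x) ^+ 2)) /=; last by move=> ? ? _ _ /a_inj.
rewrite big_mkcond [leRHS]big_mkcond /=; apply: ler_sum => x _.
have [/imsetP[i _ ->]|_] := boolP (x \in a @: _).
  by rewrite inE (introT existsP) //; exists i; rewrite eqxx.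
by case: ifP => // _; apply: sqr_ge0.
Qed.

(** * Fourier analysis on Z_n and circulant Laplacians *)

Lemma complex_prim_root_exists (R : rcfType) n : (0 < n)%N ->
  exists z : R[i], n.-primitive_root z.
Proof.
move=> n_gt0; pose p : {poly R[i]} := 'X^n - 1.
have [r Dp] := closed_field_poly_normal p.
rewrite (monicP _) ?monicXnsubC // scale1r in Dp.
have rn1 : all n.-unity_root r by apply/allP => z; rewrite -root_prod_XsubC -Dp.
have sz_r : (n < (size r).+1)%N.
  by rewrite -(size_prod_XsubC r id) -Dp size_XnsubC.
have [|z _ z_prim] := hasP (has_prim_root n_gt0 rn1 _ sz_r); last by exists z.
by rewrite -separable_prod_XsubC -Dp separable_Xn_sub_1 // pnatr_eq0 -lt0n.
Qed.

Lemma normc_unity_root (R : rcfType) n (z : R[i]) : (0 < n)%N ->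
  z ^+ n = 1 -> normc z = 1.
Proof.
move=> n_gt0 /(congr1 (@normc R)); rewrite normcX normc1 => /eqP.
by rewrite pexpr_eq1 ?normc_ge0 // => /eqP.
Qed.

Lemma normc_sqr_conj (R : rcfType) (z : R[i]) :
  ((normc z ^+ 2)%:C = z * z^*)%C.
Proof.
rewrite normc_sqr; case: z => a b /=; apply/eqP; rewrite eq_complex /=.
by apply/andP; split; apply/eqP; ring.
Qed.

Definition zn_char (R : rcfType) (n : nat) (z : R[i]) (j x : 'I_n.+1) : R[i] :=
  z ^+ (j * x).

Lemma zn_charD (R : rcfType) n (z : R[i]) (j x y : 'I_n.+1) : z ^+ n.+1 = 1 ->
  zn_char z j (x + y) = zn_char z j x * zn_char z j y.
Proof.
move=> zn1; rewrite /zn_char -exprD -mulnDr !(mulnC j) !exprM /=; congr (_ ^+ j).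
exact: expr_mod.
Qed.

Lemma normc_zn_char (R : rcfType) n (z : R[i]) (j x : 'I_n.+1) :
  z ^+ n.+1 = 1 -> normc (zn_char z j x) = 1.
Proof.
by move=> zn1; rewrite /zn_char normcX (normc_unity_root _ zn1) // expr1n.
Qed.

Lemma zn_char0 (R : rcfType) n (z : R[i]) (j : 'I_n.+1) : zn_char z j 0 = 1.
Proof. by rewrite /zn_char muln0. Qed.

Lemma zn_charN (R : rcfType) n (z : R[i]) (j x : 'I_n.+1) :
  z ^+ n.+1 = 1 -> zn_char z j (- x) = ((zn_char z j x)^*)%C.
Proof.
move=> zn1; have nz : zn_char z j x != 0.
  by rewrite expf_neq0 //; apply/eqP => z0; move/eqP: zn1; rewrite z0 expr0n eq_sym oner_eq0.
apply: (mulfI nz); rewrite -zn_charD // subrr zn_char0 -normc_sqr_conj.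
by rewrite normc_zn_char // expr1n.
Qed.

Lemma zn_char_sum (R : rcfType) n (z : R[i]) (x : 'I_n.+1) :
  n.+1.-primitive_root z ->
  \sum_(j < n.+1) zn_char z j x = (n.+1 * (x == 0))%:R.
Proof.
move=> zP; have zn1 := prim_expr_order zP.
have [->|x_neq0] := eqVneq x 0.
  by rewrite muln1 (eq_bigr (fun=> 1)) ?sumr_const ?card_ord // => j _; apply: zn_char0.
rewrite muln0; apply/eqP.
have : (z ^+ x - 1) * \sum_(j < n.+1) zn_char z j x = 0.
  rewrite (eq_bigr (fun j : 'I_n.+1 => (z ^+ x) ^+ j)).
    by rewrite -subrX1 -exprM mulnC exprM zn1 expr1n subrr.
  by move=> j _; rewrite /zn_char mulnC exprM.
move/eqP; rewrite mulf_eq0 => /orP[|//].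
rewrite subr_eq0 -(prim_order_dvd zP) /dvdn modn_small // => x0.
by move: x_neq0; rewrite -val_eqE /= x0.
Qed.

Definition zn_fourier (R : rcfType) (n : nat) (z : R[i]) (y : 'I_n.+1 -> R)
    (j : 'I_n.+1) : R[i] :=
  \sum_x (y x)%:C%C * zn_char z j x.

Lemma zn_parseval (R : rcfType) n (z : R[i]) (y : 'I_n.+1 -> R) :
  n.+1.-primitive_root z ->
  \sum_j normc (zn_fourier z y j) ^+ 2 = n.+1%:R * \sum_x y x ^+ 2.
Proof.
move=> zP; have zn1 := prim_expr_order zP; apply: complexI; rewrite rmorph_sum.
transitivity (\sum_j \sum_x \sum_x' (y x)%:C%C * (y x')%:C%C * zn_char z j (x - x')).
  apply: eq_bigr => j _; rewrite /= normc_sqr_conj /zn_fourier rmorph_sum big_distrl.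
  apply: eq_bigr => x _; rewrite big_distrr; apply: eq_bigr => x' _ /=.
  rewrite rmorphM zn_charD // zn_charN // mulrACA; congr (_ * _ * _).
  exact: conjc_real.
rewrite exchange_big rmorphM rmorph_sum rmorph_nat mulr_sumr /=.
apply: eq_bigr => x _; rewrite exchange_big (bigD1 x) //= [X in _ + X]big1.
  by rewrite addr0 -mulr_sumr zn_char_sum // subrr eqxx muln1 mulrC -expr2 rmorphXn.
move=> x' ne_x; rewrite -mulr_sumr zn_char_sum // subr_eq0 eq_sym (negbTE ne_x).
by rewrite muln0 mulr0.
Qed.

(** Translation by [s] multiplies the Fourier coefficient by [chi (- s)], and
[|chi (- s) - 1| = |1 - chi s|]. *)
Lemma zn_fourier_diff (R : rcfType) n (z : R[i]) (y : 'I_n.+1 -> R) s j :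
  z ^+ n.+1 = 1 ->
  normc (zn_fourier z (fun x => y (s + x) - y x) j) =
  normc (1 - zn_char z j s) * normc (zn_fourier z y j).
Proof.
move=> zn1; rewrite -[RHS]mul1r -(normc_zn_char j (- s) zn1) mulrA -normcM.
rewrite mulrBr mulr1 -zn_charD // addNr zn_char0 -normcM.
congr normc; rewrite mulrBl mul1r /zn_fourier.
under eq_bigr do rewrite rmorphB mulrBl.
rewrite sumrB; congr (_ - _); rewrite mulr_sumr.
rewrite [RHS](reindex_inj (addrI s)); apply: eq_bigr => x _ /=.
by rewrite mulrCA -zn_charD // addKr.
Qed.

(** The quadratic form of the circulant graph with connection set [{s, - s}], doubled
when [s = - s]. *)
Definition diff_energy (R : rcfType) (n : nat) (y : 'I_n.+1 -> R) (s : 'I_n.+1) : R :=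
  \sum_x (y (s + x) - y x) ^+ 2.

Lemma diff_energy_fourier (R : rcfType) n (z : R[i]) (y : 'I_n.+1 -> R) s :
  n.+1.-primitive_root z ->
  n.+1%:R * diff_energy y s =
  \sum_j normc (1 - zn_char z j s) ^+ 2 * normc (zn_fourier z y j) ^+ 2.
Proof.
move=> zP; rewrite -(zn_parseval _ zP); apply: eq_bigr => j _.
by rewrite zn_fourier_diff ?exprMn // prim_expr_order.
Qed.

(** By Parseval both sides are sums over the characters, with the nonnegative weights
[|y^_j|^2], of the two sides of the bound for one character. *)
Lemma pm_set_diff_energy (R : rcfType) (k n : nat) (a : 'I_k -> 'I_n.+1)
    (y : 'I_n.+1 -> R) :
  arith_progression a -> injective a ->
  Num.sqrt k%:R *
    `|\sum_(s in pm_set a) rs_sign R (pm_index a s) * diff_energy y s|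
  <= 10 * 6069 * \sum_(s in pm_set a) diff_energy y s.
Proof.
move=> a_ap a_inj; have [z zP] := @complex_prim_root_exists R n.+1 isT.
have zn1 := prim_expr_order zP; have n0 : 0 < n.+1%:R :> R by [].
(* Used with [e] the signs on the left and with [e = 1] on the right. *)
have spectral (e : 'I_n.+1 -> R) :
    n.+1%:R * (\sum_(s in pm_set a) e s * diff_energy y s) =
    \sum_j normc (zn_fourier z y j) ^+ 2 *
      \sum_(s in pm_set a) e s * normc (1 - zn_char z j s) ^+ 2.
  under [RHS]eq_bigr do rewrite mulr_sumr.
  rewrite exchange_big mulr_sumr; apply: eq_bigr => s _ /=.
  rewrite mulrCA (diff_energy_fourier _ _ zP) mulr_sumr.
  by apply: eq_bigr => j _; ring.
rewrite -(ler_pM2l n0) mulrCA -[n.+1%:R in leLHS]ger0_norm // -normrM spectral.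
rewrite [leRHS]mulrCA -[in leRHS](eq_bigr _ (fun s _ => mul1r (diff_energy y s))).
rewrite spectral.
apply: (@le_trans _ _ (\sum_j Num.sqrt k%:R * `|normc (zn_fourier z y j) ^+ 2 *
    \sum_(s in pm_set a) rs_sign R (pm_index a s) * normc (1 - zn_char z j s) ^+ 2|)).
  by rewrite -mulr_sumr ler_wpM2l ?sqrtr_ge0 // ler_norm_sum.
rewrite mulr_sumr; apply: ler_sum => j _; rewrite normrM mulrCA [leRHS]mulrCA.
rewrite ger0_norm ?sqr_ge0 // ler_wpM2l ?sqr_ge0 //.
under [X in _ <= _ * X]eq_bigr do rewrite mul1r.
apply: pm_set_discrepancy => // [x y'|x]; first exact: zn_charD.
exact: normc_zn_char.
Qed.

Lemma laplacian_sym (R : realType) m (e : rel 'I_m) :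
  (laplacian R e)^T = laplacian R e.
Proof.
rewrite /laplacian !raddf_sum; apply: eq_bigr => u _; rewrite raddf_sum.
by apply: eq_bigr => v _; rewrite /= trmx_mul trmxK.
Qed.

Definition quad_form (R : realType) m (x : 'cV[R]_m) (A : 'M[R]_m) : R :=
  (x^T *m A *m x) 0 0.

Lemma laplacian_form (R : realType) m (e : rel 'I_m) (x : 'cV[R]_m) :
  quad_form x (laplacian R e) =
  \sum_(u < m) \sum_(v < m | (u < v)%N && e u v) (x u 0 - x v 0) ^+ 2.
Proof.
rewrite /quad_form /laplacian mulmx_sumr mulmx_suml summxE.
apply: eq_bigr => u _; rewrite mulmx_sumr mulmx_suml summxE.
apply: eq_bigr => v _ /=; rewrite -!mulmxA mulmxA.
set w := delta_mx u 0 - delta_mx v 0.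
have wx : w^T *m x = (x u 0 - x v 0)%:M.
  rewrite [LHS]mx11_scalar /w linearB /= !trmx_delta mulmxBl -!rowE.
  by rewrite !mxE.
have xw : x^T *m w = (x u 0 - x v 0)%:M.
  by rewrite -[x^T *m w]trmxK trmx_mul trmxK wx tr_scalar_mx.
by rewrite wx xw mul_scalar_mx !mxE eqxx mulr1n.
Qed.


(** Summing over ordered pairs of vertices counts each edge twice and makes the sum
translation invariant. *)
Lemma laplacian_circulant_form (R : realType) n (S : {set 'I_n.+1})
    (x : 'cV[R]_n.+1) : symmetric_set S ->
  2 * quad_form x (laplacian R (circulant S)) =
  \sum_(s in S) diff_energy (fun u => x u 0) s.
Proof.
move=> S_sym; rewrite laplacian_form.
pose w (u v : 'I_n.+1) := (u - v \in S)%:R * (x u 0 - x v 0) ^+ 2.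
have wC u v : w u v = w v u by rewrite /w (S_sym (u - v)) opprB -sqrrN opprB.
have -> : \sum_(u < n.+1) \sum_(v < n.+1 | (u < v)%N && circulant S u v)
    (x u 0 - x v 0) ^+ 2 = \sum_(u < n.+1) \sum_(v < n.+1 | (u < v)%N) w u v.
  apply: eq_bigr => u _; rewrite big_mkcondr; apply: eq_bigr => v _.
  by rewrite /w /circulant; case: ifP; rewrite ?mul1r ?mul0r.
transitivity (\sum_u \sum_v w u v); last first.
  rewrite exchange_big [RHS]exchange_big; apply: eq_bigr => v _ /=.
  rewrite (reindex_inj (addIr v)) [RHS]big_mkcond; apply: eq_bigr => s _ /=.
  by rewrite /w addrK; case: ifP; rewrite ?mul1r ?mul0r.
(* Off the diagonal, the pairs [u < v] and [v < u] contribute equally. *)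
have flip : \sum_(u < n.+1) \sum_(v < n.+1 | (u < v)%N) w u v =
    \sum_(u < n.+1) \sum_(v < n.+1 | (v < u)%N) w u v.
  rewrite (exchange_big_dep xpredT) //=; apply: eq_bigr => u _.
  by apply: eq_bigr => v _; apply: wC.
rewrite mulr_natl mulr2n {2}flip -big_split; apply: eq_bigr => u _ /=.
rewrite [in RHS](bigID (fun v : 'I_n.+1 => (u < v)%N)) /=; congr (_ + _).
have wuu : w u u = 0 by rewrite /w [x u 0 - _]subrr expr0n mulr0.
rewrite [RHS](bigD1 u) ?ltnn //= wuu add0r.
by apply: eq_bigl => v; rewrite -leqNgt ltn_neqAle andbC.
Qed.


Lemma psd_combination (R : realType) n (S C : {set 'I_n.+1}) (g h : R) :
  symmetric_set S -> symmetric_set C ->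
  (forall y : 'I_n.+1 -> R,
     0 <= g * \sum_(s in S) diff_energy y s + h * \sum_(s in C) diff_energy y s) ->
  psd (g *: laplacian R (circulant S) + h *: laplacian R (circulant C)).
Proof.
move=> S_sym C_sym form_ge0; split=> [|x].
  by rewrite linearD !linearZ /= !laplacian_sym.
rewrite -/(quad_form x _).
have -> A B : quad_form x (g *: A + h *: B) = g * quad_form x A + h * quad_form x B.
  by rewrite /quad_form mulmxDr mulmxDl -!scalemxAr -!scalemxAl !mxE.
have := form_ge0 (fun u => x u 0); rewrite -!laplacian_circulant_form //.
by move: (quad_form _ _) (quad_form _ _) => p q; lra.
Qed.

Definition rs_class (k n : nat) (a : 'I_k -> 'I_n.+1) (c : bool) : {set 'I_n.+1} :=
  [set x in pm_set a | rudin_shapiro (pm_index a x) == c].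

Lemma pm_set_sym (k n : nat) (a : 'I_k -> 'I_n.+1) : symmetric_set (pm_set a).
Proof. by move=> x; rewrite -!pm_index_lt pm_indexN. Qed.

Lemma rs_class_sym (k n : nat) (a : 'I_k -> 'I_n.+1) c :
  symmetric_set (rs_class a c).
Proof.
by move=> x; rewrite [LHS]in_set [RHS]in_set pm_indexN -(pm_set_sym a x).
Qed.

(** The forms of the two classes add up to the form [q] of the whole graph and differ
by the signed sum; so the form [q_c] of either class satisfies
[|2 q_c - q| <= t q]. *)
Lemma rs_class_loewner (R : realType) (k n : nat) (a : 'I_k -> 'I_n.+1) c :
  (0 < k)%N -> arith_progression a -> injective a ->
  let t : R := 10 * 6069 / Num.sqrt k%:R in
  loewner_le ((1 / 2 - t) *: laplacian R (circulant (pm_set a)))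
             (laplacian R (circulant (rs_class a c))) /\
  loewner_le (laplacian R (circulant (rs_class a c)))
             ((1 / 2 + t) *: laplacian R (circulant (pm_set a))).
Proof.
move=> k_gt0 a_ap a_inj t.
have s_gt0 : 0 < Num.sqrt k%:R :> R by rewrite sqrtr_gt0 ltr0n.
have bounds (y : 'I_n.+1 -> R) :
    `|2 * (\sum_(s in rs_class a c) diff_energy y s) -
        \sum_(s in pm_set a) diff_energy y s| <=
    t * \sum_(s in pm_set a) diff_energy y s.
  rewrite /t mulrAC ler_pdivlMr // mulrC.
  apply: le_trans (pm_set_diff_energy y a_ap a_inj); rewrite ler_pM2l //.
  rewrite le_eqVlt; apply/orP; left; apply/eqP.
  rewrite -[RHS]mul1r -[X in _ = X * _](normr_sign R c) -normrM; congr `|_|.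
  rewrite !mulr_sumr big_mkcond [in RHS]big_mkcond.
  rewrite [\sum_(s in pm_set a) _]big_mkcond -sumrB; apply: eq_bigr => s _.
  rewrite [s \in rs_class a c]in_set /rs_sign; case: ifP => [/andP[-> /eqP ->]|].
    by rewrite mulrA -signr_addb addbb expr0; ring.
  case: ifP => [_ /= /negbT|]; last by rewrite subrr.
  by case: c; case: rudin_shapiro; rewrite // ?expr0 ?expr1 => _; ring.
have E_ge0 (y : 'I_n.+1 -> R) : 0 <= t * \sum_(s in pm_set a) diff_energy y s.
  by apply: le_trans (bounds y).
have pmS := pm_set_sym a; have clS := @rs_class_sym _ _ a c.
rewrite /loewner_le; split; rewrite -?scaleNr.
  rewrite -[laplacian R (circulant (rs_class a c))]scale1r.
  apply: psd_combination => // y; have := bounds y; rewrite ler_norml => /andP[].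
  by lra.
rewrite -[X in psd (_ - X)]scale1r -scaleNr.
apply: psd_combination => // y; have := bounds y; rewrite ler_norml => /andP[].
by lra.
Qed.

(** * The program *)

(** Total correctness with a time bound: halting is part of the claim. *)
Definition runs (p : cmd) (s : state) (T : nat) (Q : state -> Prop) : Prop :=
  exists t s', [/\ exec p s t s', (t <= T)%N & Q s'].

Lemma runs_weaken p s T T' (Q Q' : state -> Prop) : (T <= T')%N ->
  (forall s', Q s' -> Q' s') -> runs p s T Q -> runs p s T' Q'.
Proof.
move=> le_T QQ' [t [s' [ex le_t Qs']]]; exists t, s'; split=> //.
- exact: leq_trans le_t le_T.
- exact: QQ'.
Qed.

Lemma runs_seq p q s T1 T2 (Q1 Q2 : state -> Prop) : runs p s T1 Q1 ->
  (forall s', Q1 s' -> runs q s' T2 Q2) -> runs (CSeq p q) s (T1 + T2) Q2.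
Proof.
move=> [t1 [s1 [ex1 le1 /[swap] H /H]]] [t2 [s2 [ex2 le2 Q2s]]].
exists (t1 + t2)%N, s2; split=> //; last exact: leq_add.
exact: exec_Seq ex1 ex2.
Qed.

(** The natural number indexing the invariant is the number of remaining rounds. *)
Lemma runs_while x p T (Inv : nat -> state -> Prop) m s :
  (forall s', Inv 0%N s' -> reg s' x = 0%N) ->
  (forall m' s', (m' < m)%N -> Inv m'.+1 s' ->
     reg s' x != 0%N /\ runs p s' T (Inv m')) ->
  Inv m s -> runs (CWhile x p) s (m * T.+1).+1 (Inv 0%N).
Proof.
move=> inv0; elim: m s => [|m IHm] s invS inv.
  by exists 1%N, s; split=> //; apply: exec_While_zero; apply: inv0.
have [x0 [t1 [s1 [ex1 le1 inv1]]]] := invS m s (ltnSn m) inv.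
have [|t2 [s2 [ex2 le2 inv2]]] := IHm s1 _ inv1.
  by move=> m' s' lt_m'; apply: invS; apply: ltnW.
exists (t1 + t2).+1, s2; split=> //; first exact: exec_While_nonzero ex1 ex2.
by rewrite mulSn; lia.
Qed.

Fixpoint loop_free (p : cmd) : bool :=
  match p with
  | CSeq p q | CIf _ p q => loop_free p && loop_free q
  | CWhile _ _ => false
  | _ => true
  end.

(** Symbolic execution: on a loop-free command it computes by reduction, so a loop
body is verified by simplification. *)
Fixpoint run_straight (p : cmd) (s : state) : state :=
  match p with
  | CConst x c => set_reg s x c
  | CAdd x y z => set_reg s x (reg s y + reg s z)%N
  | CSub x y z => set_reg s x (reg s y - reg s z)%N
  | CRead x y => set_reg s x (memory s (reg s y))
  | CWrite x y => set_mem s (reg s x) (reg s y)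
  | CSeq p q => run_straight q (run_straight p s)
  | CIf x p q => if reg s x != 0%N then run_straight p s else run_straight q s
  | CWhile _ _ => s
  end.

Fixpoint cmd_size (p : cmd) : nat :=
  match p with
  | CSeq p q => cmd_size p + cmd_size q
  | CIf _ p q => (cmd_size p + cmd_size q).+1
  | CWhile _ p => (cmd_size p).+1
  | _ => 1
  end.

Lemma runs_straight p s (Q : state -> Prop) : loop_free p ->
  Q (run_straight p s) -> runs p s (cmd_size p) Q.
Proof.
move=> + Qs; suff H : loop_free p ->
    exists2 t, exec p s t (run_straight p s) & (t <= cmd_size p)%N.
  by case/H => t ex le_t; exists t, (run_straight p s).
elim: p s {Q Qs} => /= [x c|x y z|x y z|x y|x y|p IHp q IHq|x p IHp q IHq|//] s.
- by exists 1%N => //; apply: exec_Const.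
- by exists 1%N => //; apply: exec_Add.
- by exists 1%N => //; apply: exec_Sub.
- by exists 1%N => //; apply: exec_Read.
- by exists 1%N => //; apply: exec_Write.
- case/andP => /(IHp s)[t1 ex1 le1] /(IHq (run_straight p s))[t2 ex2 le2].
  by exists (t1 + t2)%N; [apply: exec_Seq ex1 ex2 | apply: leq_add].
case/andP => /(IHp s)[t1 ex1 le1] /(IHq s)[t2 ex2 le2].
case: ifPn => [x_neq0|]; first by exists t1.+1; [apply: exec_If_nonzero|lia].
by rewrite negbK => /eqP x0; exists t2.+1; [apply: exec_If_zero|lia].
Qed.

(** Register 1 holds [k], 2 the constant 1, 3 the index [h], 4 the parity of [h] and
5 the loop guard [k - h].  One round copies the sign of [h], stored at cell
[k + h], to cell [k + 2h] and, flipped when [h] is odd, to cell [k + 2h + 1]. *)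
Definition rs_table_body : cmd :=
  CSeq (CAdd 6 1 3) (CSeq (CRead 7 6)
  (CSeq (CAdd 6 6 3) (CSeq (CWrite 6 7)
  (CSeq (CAdd 6 6 2)
  (CSeq (CIf 4 (CSeq (CSub 7 2 7) (CConst 4 0)) (CConst 4 1))
  (CSeq (CWrite 6 7)
  (CSeq (CAdd 3 3 2) (CSub 5 1 3)))))))).

(** Registers 6 and 7 hold the residues of [a_i] and [- a_i], register 8 the index [j]
to be examined.  As truncated subtraction makes [(u - v) + (v - u)] vanish exactly
for [u = v], the guard in register 5 becomes [0] when cell [j] equals one of the
two.  Register 13 is never written and serves as the constant 0. *)
Definition search_body : cmd :=
  CSeq (CRead 9 8)
  (CSeq (CSub 10 9 6) (CSeq (CSub 11 6 9) (CSeq (CAdd 10 10 11)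
  (CSeq (CSub 11 9 7) (CSeq (CSub 12 7 9) (CSeq (CAdd 11 11 12)
  (CSeq (CIf 10 (CAdd 5 11 13) (CConst 5 0))
  (CAdd 8 8 2)))))))).

(** The index in register 3 goes down from [k], so the colours overwrite only those
input cells that later searches, which never pass their own index, do not read.
When the search stops, register 8 is one more than the least index. *)
Definition output_body : cmd :=
  CSeq (CSeq (CSub 3 3 2) (CSeq (CRead 6 3) (CSeq (CSub 7 0 6)
    (CSeq (CConst 8 0) (CConst 5 1)))))
  (CSeq (CWhile 5 search_body)
    (CSeq (CAdd 8 8 1) (CSeq (CSub 8 8 2) (CSeq (CRead 9 8) (CWrite 3 9))))).

Definition partition_prog : cmd :=
  CSeq (CSeq (CConst 2 1) (CAdd 5 1 13))
  (CSeq (CWhile 5 rs_table_body) (CWhile 3 output_body)).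

Definition constants_ok (N k : nat) (s : state) : Prop :=
  [/\ reg s 0 = N, reg s 1 = k, reg s 2 = 1 & reg s 13 = 0]%N.

(** Before the first round only the sign of 0 is known, as all cells beyond the
input contain 0; this is the reason for the maximum. *)
Definition rs_table_inv (N k : nat) (A : nat -> nat) (m : nat) (s : state) : Prop :=
  [/\ constants_ok N k s,
      [/\ (m <= k)%N, reg s 3 = (k - m)%N, reg s 4 = odd (k - m) & reg s 5 = m],
      forall i, (i < k)%N -> memory s i = A i &
      forall j, (j < maxn 1 (k - m).*2)%N -> memory s (k + j)%N = rudin_shapiro j].

Lemma rs_table_step N k A m s : rs_table_inv N k A m.+1 s ->
  runs rs_table_body s (cmd_size rs_table_body) (rs_table_inv N k A m).
Proof.
move=> [[r0 r1 r2 r13] [le_mk r3 r4 r5] memA memT]; apply: runs_straight => //.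
set h := (k - m.+1)%N in r3 r4 memT.
have Eh : (k - m)%N = h.+1 by rewrite /h; lia.
have mh : memory s (k + h)%N = rudin_shapiro h by apply: memT; lia.
rewrite /rs_table_body /= r1 r2 r3 r4 mh.
have w_lt i : (i < k)%N -> (i == (k + h + h)%N) = false /\
    (i == (k + h + h + 1)%N) = false by move=> lt_ik; split; lia.
have wT j : (j < h.+1.*2)%N -> (j < maxn 1 h.*2)%N \/ j = h.*2 \/ j = h.*2.+1.
  lia.
have at0 j : ((k + j)%N == (k + h + h)%N) = (j == h.*2) by lia.
have at1 j : ((k + j)%N == (k + h + h + 1)%N) = (j == h.*2.+1) by lia.
have r_h := rudin_shapiro_double h; have r_hS := rudin_shapiro_doubleS h.
case odd_h: (odd h); rewrite odd_h in r_hS; rewrite /= ?r1 ?r2 ?r3.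
all: split=> /=; [by split=> /=| |move=> i lt_ik; have [-> ->] := w_lt i lt_ik;
  exact: memA|].
1,3: by split=> /=; rewrite ?Eh ?addn1 //= ?odd_h // /h; lia.
all: move=> j; rewrite Eh at0 at1 (maxn_idPr (_ : 1 <= h.+1.*2)%N) // => /wT.
all: have [->|ne1] := eqVneq j h.*2.+1; first by rewrite r_hS; case: rudin_shapiro.
all: have [->|ne0] := eqVneq j h.*2; first by rewrite r_h.
all: by case=> [/memT //|[]] E; [case/eqP: ne0 | case/eqP: ne1].
Qed.

Definition search_inv (N k i x J : nat) (mem : nat -> nat) (m : nat)
    (s : state) : Prop :=
  [/\ constants_ok N k s, (m <= J.+1)%N /\ reg s 3 = i,
    [/\ reg s 6 = x, reg s 7 = (N - x)%N, reg s 8 = (J.+1 - m)%N &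
       (reg s 5 != 0%N) = (0 < m)%N] & memory s = mem].

Lemma search_step (A mem : nat -> nat) (N k i x J : nat) m s :
  (forall j, (j <= J)%N -> mem j = A j) ->
  (forall j, (j <= J)%N -> ((A j == x) || (A j == N - x)%N) = (j == J)) ->
  search_inv N k i x J mem m.+1 s ->
  runs search_body s (cmd_size search_body) (search_inv N k i x J mem m).
Proof.
move=> memA match_J [[r0 r1 r2 r13] [le_m r3] [r6 r7 r8 r5] mem_s].
apply: runs_straight => //; set j := (J - m)%N.
have r8' : reg s 8 = j by rewrite r8.
have le_jJ : (j <= J)%N by rewrite leq_subr.
have matchE := match_J j le_jJ.
have dist_neq0 u v : (u - v + (v - u) != 0)%N = (u != v) by lia.
rewrite /search_body /= r6 r7 r8' mem_s memA // dist_neq0.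
have m_pos : (0 < m)%N = (j != J) by rewrite /j; lia.
(* With [m.+1] rounds left the examined index is [j = J - m], so that no round is
   left exactly when [j] is the least index [J]. *)
case: ifP => [ne_x|/negbFE eq_x]; rewrite /= ?r2 ?r8'; split=> //=.
- by split=> //; apply: ltnW.
- split=> //; first by rewrite /j addn1 subSn.
  by rewrite r13 addn0 dist_neq0 m_pos -matchE (negbTE ne_x).
- by split=> //; apply: ltnW.
- split=> //; first by rewrite /j addn1 subSn.
  by rewrite m_pos -matchE eq_x.
Qed.

Definition output_inv (N k : nat) (A J : nat -> nat) (i : nat) (s : state) : Prop :=
  [/\ constants_ok N k s, (i <= k)%N /\ reg s 3 = i,
    forall j, (j < i)%N -> memory s j = A j,
    forall j, (j < k)%N -> memory s (k + j)%N = rudin_shapiro j &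
    forall j, (i <= j < k)%N -> memory s j = rudin_shapiro (J j)].

(** Here [J] abstracts the least-index function; the search for [a_i] ends after
[J i + 1] rounds. *)
Lemma output_step (N k : nat) (A J : nat -> nat) i s :
  (forall i, (i < k)%N -> (J i <= i)%N) ->
  (forall i j, (i < k)%N -> (j <= J i)%N ->
     ((A j == A i) || (A j == N - A i)%N) = (j == J i)) ->
  output_inv N k A J i.+1 s ->
  runs output_body s (5 + ((k.+1 * (cmd_size search_body).+1).+1 + 4))
    (output_inv N k A J i).
Proof.
move=> J_le matchJ [[r0 r1 r2 r13] [lt_ik r3] memA memT memJ].
have le_J := J_le i lt_ik; have lt_Jk := leq_ltn_trans le_J lt_ik.
set Q := search_inv N k i (A i) (J i) (memory s).
apply: (@runs_seq _ _ _ _ _ (Q (J i).+1)).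
  apply: runs_straight => //; rewrite /= r3 r2 subn1 r0 memA //.
  by split=> //=; rewrite subnn.
move=> s1 inv1; apply: (@runs_seq _ _ _ _ _ (Q 0%N)).
  have : runs (CWhile 5 search_body) s1
      ((J i).+1 * (cmd_size search_body).+1).+1 (Q 0%N).
    apply: (@runs_while _ _ _ Q) inv1 => [s' [_ _ [_ _ _ r5] _]|m s' lt_m inv].
      by apply/eqP; move: r5; case: eqP.
    split; first by case: inv => _ _ [_ _ _ ->] _.
    apply: search_step inv => j le_j; first by apply: memA; lia.
    exact: matchJ.
  apply: runs_weaken => //.
  by rewrite ltnS leq_mul // ltnS ltnW.
move=> s2 [[r0' r1' r2' r13'] [_ r3'] [r6 r7 r8 r5] mem2].
apply: runs_straight; first by [].
rewrite /= r1' r8 subn0 r2' (_ : (J i).+1 + k - 1 = k + J i)%N; last lia.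
rewrite mem2 memT // r3'; split=> //=.
- by split=> //; apply: ltnW.
- by move=> j lt_ji; rewrite mem2 ltn_eqF // memA // ltnW.
- by move=> j lt_jk; rewrite mem2 gtn_eqF ?memT //; lia.
move=> j /andP[le_ij lt_jk]; have [->//|ne_j] := eqVneq j i.
by rewrite mem2 memJ // lt_jk andbT ltn_neqAle eq_sym ne_j.
Qed.

Lemma partition_prog_correct (N k : nat) (A J : nat -> nat) (s : state) :
  (forall i, (i < k)%N -> (J i <= i)%N) ->
  (forall i j, (i < k)%N -> (j <= J i)%N ->
     ((A j == A i) || (A j == N - A i)%N) = (j == J i)) ->
  reg s 0 = N -> reg s 1 = k -> (forall i, (1 < i)%N -> reg s i = 0%N) ->
  (forall i, (i < k)%N -> memory s i = A i) -> memory s k = 0%N ->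
  runs partition_prog s
    (2 + ((k * (cmd_size rs_table_body).+1).+1 +
       (k * (5 + ((k.+1 * (cmd_size search_body).+1).+1 + 4)).+1).+1))
    (fun s' => forall i, (i < k)%N -> memory s' i = rudin_shapiro (J i)).
Proof.
move=> J_le matchJ r0 r1 r_z memA memk.
apply: (@runs_seq _ _ _ _ _ (rs_table_inv N k A k)).
  apply: runs_straight => //; rewrite /= r1 !r_z // addn0.
  split=> //=.
  - by split=> //=; rewrite r_z.
  - by rewrite subnn !r_z.
  by move=> j; rewrite subnn ltnS leqn0 => /eqP ->; rewrite addn0 memk.
move=> s1 inv1; apply: runs_seq.
  apply: (@runs_while _ _ _ (rs_table_inv N k A)) inv1 => [s' [_ [_ _ _ ->]]//|m s' _].
  by move=> inv; split; [case: inv => _ [_ _ _ ->] | apply: rs_table_step].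
move=> s2 [c2 [_ r3 _ _] memA2 memT2].
have inv2 : output_inv N k A J k s2.
  rewrite subn0 in r3 memT2; split=> // j; last by rewrite ltnNge andbN.
  by move=> lt_jk; apply: memT2; lia.
apply: runs_weaken (leqnn _) _ (runs_while _ _ inv2).
- by move=> s' [_ _ _ _ H] i lt_ik; apply: H.
- by move=> s' [_ [_ ->]].
move=> m s' _ inv; split; first by case: inv => _ [_ ->].
exact: output_step.
Qed.

(** * The theorem *)

Lemma input_memory (k n : nat) (a : 'I_k -> 'I_n.+1) (i : 'I_k) :
  memory (input a) i = a i.
Proof. by rewrite /= valK. Qed.

Lemma zn_opp_val n (x y : 'I_n.+1) : x != 0 ->
  (y == n.+1 - x :> nat)%N = (y == - x).
Proof.
move=> x_neq0; rewrite -val_eqE /= modn_small //.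
have : (x : nat) != 0%N by rewrite -val_eqE in x_neq0.
lia.
Qed.

Lemma partition_prog_input (k n : nat) (a : 'I_k -> 'I_n.+1) :
  injective a -> 0 \notin pm_set a ->
  runs partition_prog (input a)
    (2 + ((k * (cmd_size rs_table_body).+1).+1 +
       (k * (5 + ((k.+1 * (cmd_size search_body).+1).+1 + 4)).+1).+1))
    (fun s => forall i : 'I_k, memory s i = rudin_shapiro (pm_index a (a i))).
Proof.
move=> a_inj a_neq0.
pose J i := if insub i is Some j then pm_index a (a j) else i : nat.
have JE (i : 'I_k) : J i = pm_index a (a i) by rewrite /J valK.
have J_le (i : 'I_k) : (J i <= i)%N by rewrite JE pm_index_le ?eqxx.
apply: (runs_weaken (leqnn _)) (partition_prog_correct
  (N := n.+1) (k := k) (A := memory (input a)) (J := J) _ _ _ _ _ _ _) => //.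
- by move=> s sP i; rewrite sP ?JE.
- by move=> i lt_ik; apply: (J_le (Ordinal lt_ik)).
- move=> i0 j0 lt_ik; pose i := Ordinal lt_ik; rewrite -[i0]/(val i) => le_j.
  have lt_jk : (j0 < k)%N by apply: leq_ltn_trans le_j (leq_ltn_trans (J_le i) lt_ik).
  pose j := Ordinal lt_jk; rewrite -[j0]/(val j) in le_j *.
  rewrite !input_memory zn_opp_val; last first.
    apply: contraNneq a_neq0 => <-; rewrite inE.
    by apply/existsP; exists i; rewrite eqxx.
  rewrite [(a j == a i :> nat)%N]val_eqE JE in le_j *.
  apply/idP/eqP => [/pm_index_le le_i | /esym /pm_index_mem //].
  by apply/eqP; rewrite eqn_leq le_j.
- by case=> [|[]].
- by rewrite /= insubF ?ltnn.
Qed.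
Theorem theorem1p2 (R : realType) :
  exists c : R, 0 < c /\
  exists (prog : cmd) (p : {poly nat}),
  forall (k n : nat) (a : 'I_k -> 'I_n.+1),
    (0 < k)%N ->
    arith_progression a ->
    injective a ->
    0 \notin pm_set a ->
    exists (t : nat) (s : state) (C1 C2 : {set 'I_n.+1}),
      [/\ exec prog (input a) t s,
          (t <= p.[k])%N,
          output_part s a C1 C2,
          [/\ C1 :|: C2 = pm_set a, [disjoint C1 & C2],
              symmetric_set C1 & symmetric_set C2] &
          forall C : {set 'I_n.+1}, C = C1 \/ C = C2 ->
            loewner_le ((1 / 2 - c / Num.sqrt k%:R) *:
                          laplacian R (circulant (pm_set a)))
                       (laplacian R (circulant C)) /\
            loewner_le (laplacian R (circulant C))
                       ((1 / 2 + c / Num.sqrt k%:R) *: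
                          laplacian R (circulant (pm_set a)))].
Proof.
(* [6069] is the constant for prefixes of the progression, [10] the loss due to
   coincidences [a_i = - a_j]. *)
exists (10 * 6069); split; first by rewrite mulr_gt0.
(* [36 (k + 1)^2] majorizes the quadratic time bound of the program. *)
exists partition_prog, (('X + 1) * ('X + 1) * (36%N)%:P) => k n a k_gt0 a_ap a_inj a_neq0.
have [t [s [ex_s le_t mem_s]]] := partition_prog_input a_inj a_neq0.
exists t, s, (rs_class a false), (rs_class a true); split=> //.
- rewrite !hornerM hornerD hornerX !hornerC; apply: leq_trans le_t _.
  by rewrite -[leqRHS]/((k + 1) * (k + 1) * 36)%N /=; nia.
- move=> i; rewrite mem_s; have : a i \in pm_set a.
    by rewrite inE; apply/existsP; exists i; rewrite eqxx.
  by case rs: rudin_shapiro => a_in /=; rewrite in_set a_in rs.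
- split; try exact: rs_class_sym.
    apply/setP => x; rewrite in_setU ![x \in rs_class _ _]in_set -andb_orr.
    by case: rudin_shapiro; rewrite andbT.
  rewrite -setI_eq0; apply/eqP/setP => x.
  rewrite in_setI ![x \in rs_class _ _]in_set in_set0.
  by case: (x \in _); case: rudin_shapiro.
by move=> C [->|->]; apply: rs_class_loewner.
Qed.
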